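(* If $f_1=0$ in Problem 1, then the system is not exactly controllable for any $T>0$. That is, for every $T>0$ the following fails: there is a constant $C$ such that for every $(\phi_1,\phi_2)\in\mathcal H^1_0\times\mathcal H$ there exists $f_2\in H^1_0(0,T)$ for which the solution $u^{(0,f_2)}$ of Problem 1 with controls $(0,f_2)$ satisfies $u^{(0,f_2)}(\cdot,T)=\phi_1$, $u_t^{(0,f_2)}(\cdot,T)=\phi_2$ and $\|f_2\|_{H^1(0,T)}\le C(\|\phi_1\|_{\mathcal H^1}+\|\phi_2\|_{\mathcal H})$.
   Context: Let $a,l>0$. The lasso graph $\Omega$ consists of a ring with one attached edge. The attached edge $e_1$ is identified with $(0,l)$: $x=l$ is the boundary vertex and $x=0$ is the interior vertex where the ring is attached. The ring, of length $2a$, is split at its midpoint (an artificial vertex) into two edges $e_2,e_3$, each identified with $(0,a)$, with $x=0$ the common interior vertex of $e_1,e_2,e_3$ and $x=a$ the midpoint of the ring. Alternatively the whole ring is one edge $e_r=(0,2a)$ starting and ending at the interior vertex: a function $\phi$ on the ring is $\phi_r(x)=\phi_2(x)$ for $0<x<a$ and $\phi_r(x)=\phi_3(2a-x)$ for $a<x<2a$. The restriction of a function $u$ to $e_j$ is $u_j$. At a vertex, $\partial u_j$ denotes the derivative of $u$ along the incident edge $e_j$ in the direction pointing outward from the vertex. The potential $q$ is real valued with $q_j=q|_{e_j}\in L^1(e_j)$, $j=1,2,3$. Spaces: $\mathcal H=L^2(\Omega)$; $\mathcal H^1=\{\phi\in\mathcal H:\ \phi_1\in H^1(e_1),\ \phi_r\in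 H^1(e_r)\}$ with $\|\phi\|_{\mathcal H^1}^2=\|\phi'\|^2_{L^2(e_1)}+\|\phi'\|^2_{L^2(e_r)}+\|\phi\|^2_{\mathcal H}$; $\mathcal H^1_0=\{\phi\in\mathcal H^1:\ \phi_1(0)=\phi_r(0)=\phi_r(2a)\}$. $H^1_0(0,T)$ is the set of $f\in H^1(0,T)$ with $f(0)=f(T)=0$. Problem 1, with controls $(f_1,f_2)$: $u_{tt}-u_{xx}+q(x)u=0$ for $t>0$, $x\in e_1\cup e_2\cup e_3$; $u_2(a,t)=u_3(a,t)$, $\partial u_2(a,t)+\partial u_3(a,t)=0$ for $t>0$; $u(x,0)=u_t(x,0)=0$ for $x\in\Omega$; $\partial u_1(l,t)=f_1(t)$ for $t>0$; $u_2(0,t)-u_1(0,t)=f_2(t)$, $u_3(0,t)-u_1(0,t)=0$, $\sum_{j=1}^3\partial u_j(0,t)=0$ for $t>0$. Solutions are understood in the generalized sense: let $D$ be the set of $\varphi\in\mathcal H$ with $\varphi_j,\varphi_j'$ absolutely continuous on each closed edge, $A\varphi:=-\varphi''+q\varphi\in\mathcal H$, $\varphi_1'(l)=0$, $\varphi_2(a)=\varphi_3(a)$, $\partial\varphi_2(a)+\partial\varphi_3(a)=0$, $\varphi_1(0)=\varphi_2(0)=\varphi_3(0)$, $\sum_{j=1}^3\partial\varphi_j(0)=0$. Then $u\in C([0,T];\mathcal H)$ is the solution if for every $\varphi\in D$ the function $m_\varphi(t)=\langle u(\cdot,t),\varphi\rangle_{\mathcal H}$ is in $H^2(0,T)$,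 $m_\varphi(0)=m_\varphi'(0)=0$, and $m_\varphi''(t)+\langle u(\cdot,t),A\varphi\rangle_{\mathcal H}=-f_1(t)\varphi_1(l)+f_2(t)\,\partial\varphi_2(0)$ for a.e. $t$. The equality $u_t(\cdot,T)=\psi$ with $\psi\in\mathcal H$ means $m_\varphi'(T)=\langle\psi,\varphi\rangle_{\mathcal H}$ for all $\varphi\in D$. *)

(* Defs.v *)
From HB Require Import structures.
From mathcomp Require Import all_boot all_order all_algebra.
From mathcomp Require Import all_classical all_reals all_analysis.
Import Order.TTheory GRing.Theory Num.Theory numFieldNormedType.Exports.

Set Implicit Arguments.
Unset Strict Implicit.
Unset Printing Implicit Defensive.

Local Open Scope classical_set_scope.
Local Open Scope ring_scope.

(* All function spaces are real.  Elements of L^2 are represented by functions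
   R -> R, of which only the restriction to the relevant interval matters. *)

Section Interval.
Variable R : realType.
Local Notation mu := (@lebesgue_measure R).

Definition L1_itv (b : R) (f : R -> R) : Prop :=
  mu.-integrable `[0, b] (EFin \o f).

Definition L2_itv (b : R) (f : R -> R) : Prop :=
  f \_ `[0, b] \in Lfun mu 2%:E.

Definition L2_inner (b : R) (f g : R -> R) : R :=
  \int[mu]_(x in `[0, b]) (f x * g x).

Definition abs_continuous (b : R) (f : R -> R) : Prop :=
  forall eps : R, 0 < eps -> exists2 delta : R, 0 < delta &
    forall (n : nat) (s t : 'I_n -> R),
      (forall i, 0 <= s i <= t i /\ t i <= b) ->
      (forall i j, i != j -> t i <= s j \/ t j <= s i) ->
      \sum_(i < n) (t i - s i) < delta ->
      \sum_(i < n) `|f (t i) - f (s i)| < eps.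

(* f is the continuous representative of an element of H^1(0, b), and df
   represents its weak derivative (unique up to a null set). *)
Definition H1_itv (b : R) (f df : R -> R) : Prop :=
  L2_itv b df /\
  (forall x, 0 <= x <= b -> f x = f 0 + \int[mu]_(y in `[0, x]) df y).

Definition H1_itv_norm (b : R) (f df : R -> R) : R :=
  Num.sqrt (L2_inner b f f + L2_inner b df df).

Definition H10_itv (b : R) (f df : R -> R) : Prop :=
  [/\ H1_itv b f df, f 0 = 0 & f b = 0].

(* df is the continuous representative of the derivative of f. *)
Definition H2_itv (b : R) (f df ddf : R -> R) : Prop :=
  H1_itv b f df /\ H1_itv b df ddf.

End Interval.

Inductive edge := e1 | e2 | e3.

Section Lasso.
Variable R : realType.
Variables a l : R.
Local Notation mu := (@lebesgue_measure R).
Local Notation gfun := (edge -> R -> R).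

Definition edge_len (e : edge) : R := match e with e1 => l | _ => a end.

Definition L2_graph (u : gfun) : Prop := forall e, L2_itv (edge_len e) (u e).

Definition H_inner (u v : gfun) : R :=
  L2_inner (edge_len e1) (u e1) (v e1) + L2_inner (edge_len e2) (u e2) (v e2)
  + L2_inner (edge_len e3) (u e3) (v e3).

Definition Hnorm (u : gfun) : R := Num.sqrt (H_inner u u).

Definition Hdist (u v : gfun) : R := Hnorm (fun e x => u e x - v e x).

Definition ae_eq_graph (u v : gfun) : Prop :=
  forall e, {ae mu, forall x, 0 < x < edge_len e -> u e x = v e x}.

(* The ring as a single edge (0, 2a), the edge e3 being run backwards.  For
   continuous representatives the value u e3 a is thus irrelevant. *)
Definition on_ring (u : gfun) : R -> R :=
  fun x => if x <= a then u e2 x else u e3 (2 * a - x).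

(* d1 and dr represent the derivatives of phi on e_1 and on e_r. *)
Definition H1_graph (phi : gfun) (d1 dr : R -> R) : Prop :=
  [/\ L2_graph phi, H1_itv l (phi e1) d1 & H1_itv (2 * a) (on_ring phi) dr].

Definition H1_graph_norm (phi : gfun) (d1 dr : R -> R) : R :=
  Num.sqrt (L2_inner l d1 d1 + L2_inner (2 * a) dr dr + Hnorm phi ^+ 2).

Definition H10_graph (phi : gfun) (d1 dr : R -> R) : Prop :=
  [/\ H1_graph phi d1 dr, phi e1 0 = on_ring phi 0
    & on_ring phi 0 = on_ring phi (2 * a)].

(* Derivatives at the two ends of an edge, outward from the vertex, in terms
   of the derivative du in the edge coordinate. *)
Definition out0 (du : gfun) (e : edge) : R := du e 0.
Definition outL (du : gfun) (e : edge) : R := - du e (edge_len e).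

Definition Aop (q phi ddphi : gfun) : gfun :=
  fun e x => - ddphi e x + q e x * phi e x.

(* phi belongs to the domain D, with phi' = dphi on the closed edges and
   phi'' = ddphi almost everywhere. *)
Record in_dom (q phi dphi ddphi : gfun) : Prop := InDom {
  dom_L2 : L2_graph phi;
  dom_ac : forall e, abs_continuous (edge_len e) (phi e);
  dom_derive : forall e x, 0 < x < edge_len e ->
    is_derive x (1 : R) (phi e) (dphi e x);
  dom_ac' : forall e, abs_continuous (edge_len e) (dphi e);
  dom_derive2 : forall e, {ae mu, forall x, 0 < x < edge_len e ->
    is_derive x (1 : R) (dphi e) (ddphi e x)};
  dom_A : L2_graph (Aop q phi ddphi);
  dom_end : dphi e1 l = 0;
  dom_mid : phi e2 a = phi e3 a;
  dom_mid' : outL dphi e2 + outL dphi e3 = 0;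
  dom_node12 : phi e1 0 = phi e2 0;
  dom_node23 : phi e2 0 = phi e3 0;
  dom_node' : out0 dphi e1 + out0 dphi e2 + out0 dphi e3 = 0
}.

Definition moment (u : R -> gfun) (phi : gfun) : R -> R :=
  fun t => H_inner (u t) phi.

(* u is the generalized solution of the initial boundary value problem with
   controls (f1, f2); u t is the state at time t. *)
Record is_solution (q : gfun) (T : R) (f1 f2 : R -> R) (u : R -> gfun) :
    Prop := IsSolution {
  sol_L2 : forall t, 0 <= t <= T -> L2_graph (u t);
  sol_continuous : forall t0, 0 <= t0 <= T ->
    Hdist (u t) (u t0) @[t --> within `[0, T] (nbhs t0)] --> (0 : R);
  sol_moment : forall phi dphi ddphi, in_dom q phi dphi ddphi ->
    exists dm ddm : R -> R,
      [/\ H2_itv T (moment u phi) dm ddm, moment u phi 0 = 0, dm 0 = 0 &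
        {ae mu, forall t, 0 < t < T ->
          ddm t + H_inner (u t) (Aop q phi ddphi)
          = - f1 t * phi e1 l + f2 t * out0 dphi e2}]
}.

(* u_t(., T) = psi *)
Definition velocity_at (q : gfun) (T : R) (u : R -> gfun) (psi : gfun) : Prop :=
  forall phi dphi ddphi, in_dom q phi dphi ddphi ->
    exists dm ddm : R -> R,
      H2_itv T (moment u phi) dm ddm /\ dm T = H_inner psi phi.

End Lasso.

(* Main.v *)
(**
The control cannot reach every final velocity, whatever the constant C. If phi
is in D with A phi = lam phi + h, then m(t) = <u(t), phi> solves
m'' + lam m = f_2 d - <u(t), h>, with d the outward derivative of phi_2 at 0, so
Duhamel's formula and one integration by parts on f_2 (which vanishes at both
ends) give
  |<u_t(T), phi>| <= |d| ||f_2'||_1 / sqrt lam + T sup |<u(t), h>|,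
where sup ||u(t)|| is finite because u is continuous on [0, T]. There are such
quasimodes with h -> 0, lam -> oo, d bounded and phi_2 close to
cos(n pi x / a). A gliding hump then produces one psi, a sum of 8^-j cos(n_j pi x / a),
whose inner products with the quasimodes decay more slowly than these bounds.

The quasimodes use that, by Dirichlet's theorem, n l / a is within O(1/n) of an
integer m for infinitely many n. On an edge of length b one solves
  - phi'' + q phi = (k^2 + s) phi + h,   k = n pi / b,
with phi(0) = 1, phi'(0) = (s b - int q) / 2, phi(b) = (-1)^n, phi'(b) = 0 as a
fixed point of a Volterra-type operator, where the residual h, a combination of
cos(k x) and sin(k x), absorbs the overdetermination; it is small by the
Riemann-Lebesgue lemma. Choosing lam so that the three values of phi'(0) add up to 0
keeps the shifts s bounded, because k^2 differs by O(1) between the edges.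
*)

Require Import Defs.
From mathcomp Require Import all_boot all_order all_algebra.
From mathcomp Require Import all_classical all_reals all_analysis.
From mathcomp Require Import measurable_realfun ring lra.
Import Order.TTheory GRing.Theory Num.Theory numFieldNormedType.Exports.
Set Implicit Arguments.
Unset Strict Implicit.
Unset Printing Implicit Defensive.
Local Open Scope classical_set_scope.
Local Open Scope ring_scope.

(** * Primitives of integrable functions *)

Section RealIntegrals.
Context {R : realType}.
Local Notation mu := (@lebesgue_measure R).
(* The type R carries two convertible measurable structures with different
   displays; lebesgue_measure lives on measurableTypeR. *)
Local Notation mset := (@measurable _ (measurableTypeR R)).
Local Notation mfun := (@measurable_fun _ _ (measurableTypeR R) R).
Implicit Types (D E : set R) (f g c : R -> R) (a b k x y M : R).

(** A mode of frequency k normally has d of order k, which cancels the gain 1 / sqrt lam. For d to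
    stay bounded, the mode must be nearly a Neumann cosine at the node on all three edges, and by
    continuity there [e1] cannot be left out: k a and k l must both be close to multiples of pi. If
    q = 0 and l / a is rational, such modes exist exactly, with d = 0, and the control does not see
    them at all.

    Exact eigenfunctions are avoided because the ring also carries modes sin(n pi x / a), opposite
    on its two halves, with the same frequency when q = 0 and with d of order k. Eigenvalues may
    thus be nearly double, and an eigenfunction an uncontrolled mixture of both kinds. A quasimode
    can be prescribed instead, and its residual costs only a term proportional to h.

    The control, the solution and its bound depend on psi, hence on the whole sequence of modes, so
    the rates are fixed beforehand: residuals 16^-j and lam >= 16^(2j) make every error a constant
    times 16^-j, which loses to 8^-j whatever the constant is. *)

Definition intg D f : Prop := mu.-integrable D (EFin \o f).

Lemma intg_measurable D f : intg D f -> mfun D f.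
Proof. by move=> /integrableP[/measurable_EFinP]. Qed.

Lemma intgS D E f : mset D -> mset E -> E `<=` D ->
  intg D f -> intg E f.
Proof. by move=> mD mE ED; exact: integrableS. Qed.

Lemma eq_intg D f g : mset D -> {in D, f =1 g} -> intg D f -> intg D g.
Proof. by move=> mD fg; apply: eq_integrable => // x xD /=; rewrite fg. Qed.

Lemma intgD D f g : mset D -> intg D f -> intg D g ->
  intg D (fun x => f x + g x).
Proof. by move=> mD; exact: integrableD. Qed.

Lemma intgB D f g : mset D -> intg D f -> intg D g ->
  intg D (fun x => f x - g x).
Proof. by move=> mD; exact: integrableB. Qed.

Lemma intg_norm D f : intg D f -> intg D (fun x => `|f x|).
Proof. exact: integrable_norm. Qed.

Lemma intgM D c f M : mset D -> mfun D c ->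
  (forall x, D x -> `|c x| <= M) -> intg D f -> intg D (fun x => c x * f x).
Proof.
move=> mD mc cM fi; apply: (@integrableMr _ _ _ mu D mD c (EFin \o f)) => //.
exists M; split; first exact: num_real.
by move=> N MN x Dx /=; rewrite (le_trans (cM _ Dx))// ltW.
Qed.

Lemma intgMl D c f M : mset D -> mfun D c ->
  (forall x, D x -> `|c x| <= M) -> intg D f -> intg D (fun x => f x * c x).
Proof.
move=> mD mc cM fi; apply: (@eq_intg _ (fun x => c x * f x)) => //.
  by move=> x _; rewrite mulrC.
exact: (@intgM _ _ _ M).
Qed.

Lemma intgZ D f k : mset D -> intg D f -> intg D (fun x => k * f x).
Proof. by move=> mD; exact: integrableZl. Qed.

Lemma intg_bounded a b f M : mfun `[a, b] f ->
  (forall x, a <= x <= b -> `|f x| <= M) -> intg `[a, b] f.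
Proof.
move=> mf fM; apply: measurable_bounded_integrable => //.
  by rewrite /= lebesgue_measure_itv; case: ifPn => //= _; rewrite -EFinD ltry.
exists M; split; first exact: num_real.
by move=> N MN x /=; rewrite in_itv/= => abx; rewrite (le_trans (fM x abx))// ltW.
Qed.

Lemma le_norm_Rintegral D f g : mset D -> intg D f -> intg D g ->
  (forall x, D x -> `|f x| <= g x) -> `|\int[mu]_(x in D) f x| <= \int[mu]_(x in D) g x.
Proof.
move=> mD fi gi fg; apply: (le_trans (le_normr_Rintegral mD fi)).
by apply: le_Rintegral => //; exact: intg_norm.
Qed.

Lemma Rintegral_sub D E f : mset D -> mset E -> E `<=` D ->
  intg D f -> (forall x, D x -> 0 <= f x) ->
  \int[mu]_(x in E) f x <= \int[mu]_(x in D) f x.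
Proof.
move=> mD mE ED fi f0; apply: fine_le.
- by apply: integrable_fin_num => //; exact: integrableS fi.
- exact: integrable_fin_num.
- apply: ge0_subset_integral => //.
  by apply/measurable_EFinP; exact: intg_measurable.
Qed.

Lemma Rintegral_itv_le a b f M : a <= b -> intg `[a, b] f ->
  (forall x, a <= x <= b -> `|f x| <= M) ->
  `|\int[mu]_(x in `[a, b]) f x| <= M * (b - a).
Proof.
move=> ab fi fM.
have -> : M * (b - a) = \int[mu]_(x in `[a, b]) M.
  rewrite Rintegral_cst//= lebesgue_measure_itv/= lte_fin.
  case: ltP => //= ba; have -> : a = b by apply/eqP; rewrite eq_le ab ba.
  by rewrite subrr.
apply: le_norm_Rintegral => //; first exact: (@intg_bounded _ _ _ `|M|).
Qed.

(** For negative [x] the interval is empty, so [prim f] is extended by 0. It stays continuous on the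
    whole line when [f] is integrable, but its derivative is used only at points [0 < x]. *)
Definition prim f x := \int[mu]_(t in `[0, x]) f t.

Lemma prim0 f : prim f 0 = 0.
Proof. by rewrite /prim set_itv1 Rintegral_set1. Qed.

Lemma prim_le0 f x : x <= 0 -> prim f x = 0.
Proof.
rewrite le_eqVlt => /predU1P[->|x0]; first exact: prim0.
by rewrite /prim set_itv_ge ?Rintegral_set0// bnd_simp -ltNge.
Qed.

Lemma intg_itv f (i : interval R) : intg setT f -> intg [set` i] f.
Proof. exact: intgS. Qed.

(** Through this, facts about functions integrable on the whole line transfer to functions
    integrable on [[0, b]] only. *)
Lemma prim_restrict b f x : x <= b -> prim (f \_ `[0, b]) x = prim f x.
Proof.
move=> xb; apply: eq_Rintegral => t; rewrite inE/= in_itv/= => /andP[t0 tx].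
by rewrite patchE mem_set//= in_itv/= t0 (le_trans tx xb).
Qed.

Lemma prim_itvB f a b : intg `[0, b] f -> 0 <= a -> a <= b ->
  prim f b - prim f a = \int[mu]_(t in `]a, b]) f t.
Proof. by move=> fi a0 ab; rewrite /prim Rintegral_itvB ?bnd_simp. Qed.

Lemma norm_prim f x : intg setT f -> `|prim f x| <= \int[mu]_t `|f t|.
Proof.
move=> fi; apply: (@le_trans _ _ (\int[mu]_(t in `[0, x]) `|f t|)).
  by apply: le_normr_Rintegral => //; exact: intg_itv.
apply: Rintegral_sub => //; exact: intg_norm.
Qed.

(** The increments add up to at most the integral of [|f|] over the union of the intervals, which is
    small when the measure of the union is. *)
Lemma abs_continuous_prim b f : intg setT f -> abs_continuous b (prim f).
Proof.
move=> fi eps e0; have [d [d0 dP]] := integral_normr_continuous fi e0.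
exists d => // n s t st dis sumd.
(* Half-open intervals stay disjoint when they share an endpoint, and are empty when [s i = t i]. *)
pose F i : set (measurableTypeR R) := `]s i, t i]%classic.
have mF i : mset (F i) by exact: measurable_itv.
have tF : trivIset setT F.
  apply/trivIsetP => i j _ _ ij; rewrite -subset0 => x [].
  rewrite /F /= !in_itv/= => /andP[sx xt] /andP[sx' xt'].
  case: (dis i j ij) => h.
    by move: (lt_le_trans sx' xt) => /lt_le_trans/(_ h); rewrite ltxx.
  by move: (lt_le_trans sx xt') => /lt_le_trans/(_ h); rewrite ltxx.
have tF' : trivIset [set` index_enum 'I_n] F.
  by apply: sub_trivIset tF.
pose A := \big[setU/set0]_(i < n) F i.
have mA : mset A by apply: bigsetU_measurable => i _; exact: mF.
have muA : (mu A < d%:E)%E.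
  rewrite /A measure_bigsetU_ord//=.
  rewrite (eq_bigr (fun i => (t i - s i)%:E)); last first.
    move=> i _; rewrite lebesgue_measure_itv/= lte_fin.
    case: ltP => //= ts; have -> : s i = t i; last by rewrite subrr.
    by apply/eqP; rewrite eq_le ts; have [/andP[_ ->]] := st i.
  by rewrite sumEFin lte_fin.
apply: le_lt_trans (dP A mA muA).
have fA : intg A (fun x => `|f x|) by apply: intgS (intg_norm fi).
have -> : \int[mu]_(x in A) `|f x| = \sum_(i < n) \int[mu]_(x in F i) `|f x|.
  apply: EFin_inj; rewrite -sumEFin /Rintegral fineK; last exact: integrable_fin_num.
  rewrite /A integral_bigsetU_EFin//=.
  2: exact: index_enum_uniq.
  2: by apply/measurable_EFinP; exact: intg_measurable fA.
  apply: eq_bigr => i _; rewrite fineK//; apply: integrable_fin_num => //.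
  by apply: intgS (intg_norm fi).
apply: ler_sum => i _; have [/andP[s0 st'] _] := st i.
rewrite prim_itvB//; last exact: intg_itv.
by apply: le_normr_Rintegral => //; exact: intg_itv.
Qed.

End RealIntegrals.

Section Primitives.
Context {R : realType}.
Local Notation mu := (@lebesgue_measure R).
Local Notation mset := (@measurable _ (measurableTypeR R)).
Local Notation mfun := (@measurable_fun _ _ (measurableTypeR R) R).
Implicit Types (D E : set R) (f g c : R -> R) (a b k x y M : R).

Lemma continuous_mfun D f : continuous f -> mset D -> mfun D f.
Proof.
move=> cf mD; apply: (@measurable_funS _ _ _ _ setT) => //.
exact: continuous_measurable_fun.
Qed.

Lemma continuous_itv_bounded a b f : continuous f ->
  exists2 M : R, 0 <= M & forall x, a <= x <= b -> `|f x| <= M.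
Proof.
move=> cf; have [ab|ba] := leP a b; last first.
  by exists 0 => // x /andP[ax xb]; move: (le_trans ax xb); rewrite leNgt ba.
have cn : {within `[a, b], continuous (fun x => `|f x|)}.
  apply: continuous_subspaceT => x.
  by apply: (continuous_comp (cf x)); exact: norm_continuous.
have [c _ cM] := EVT_max ab cn; by exists `|f c|.
Qed.

Lemma continuous_intg a b f : continuous f -> intg `[a, b] f.
Proof.
move=> cf; have [M _ fM] := continuous_itv_bounded a b cf.
by apply: (@intg_bounded _ _ _ _ M) => //; exact: continuous_mfun.
Qed.

Lemma prim_max0 f x : prim f (Num.max 0 x) = prim f x.
Proof. by case: (leP 0 x) => // x0; rewrite prim0 prim_le0// ltW. Qed.

(** The one-interval case of [abs_continuous_prim]. Passing to positive parts changes nothing by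
    [prim_max0] and brings both points into the range where absolute continuity applies. *)
Lemma prim_continuous f : intg setT f -> continuous (prim f).
Proof.
move=> fi x; apply/cvgrPdist_lt => e e0.
have [d d0 dP] := abs_continuous_prim (`|x| + 1) fi e0.
have main y z : 0 <= y <= z -> z <= `|x| + 1 -> z - y < d ->
    `|prim f z - prim f y| < e.
  move=> yz zx zyd.
  have := dP 1%N (fun=> y) (fun=> z); rewrite !big_ord_recl !big_ord0 !addr0.
  by apply=> // i j; rewrite !ord1.
have m0 : 0 < Num.min d 1 by rewrite lt_min d0 ltr01.
near=> y.
have xyd : `|x - y| < Num.min d 1.
  by near: y; apply/nbhs_ballP; exists (Num.min d 1).
rewrite -(prim_max0 f x) -(prim_max0 f y).
have xx : x <= `|x| := ler_norm x.
have x0 : 0 <= `|x| := normr_ge0 x.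
move: xyd; rewrite lt_min => /andP[].
have [xy|yx] := leP x y.
  rewrite ler0_norm; last lra.
  move=> xyd xy1; rewrite distrC; apply: main.
  - by rewrite le_max lexx/= ge_max !le_max lexx xy/= orbT.
  - by rewrite ge_max; apply/andP; split; lra.
  - by case: (leP 0 x) => ?; case: (leP 0 y) => ?; lra.
rewrite gtr0_norm; last lra.
move=> xyd xy1; apply: main.
- by rewrite le_max lexx/= ge_max !le_max lexx (ltW yx)/= orbT.
- by rewrite ge_max; apply/andP; split; lra.
- by case: (leP 0 x) => ?; case: (leP 0 y) => ?; lra.
Unshelve. all: by end_near. Qed.

Lemma prim_ae_derive f : intg setT f ->
  {ae mu, forall x, 0 < x -> is_derive x (1 : R) (prim f) (f x)}.
Proof.
move=> fi; have := @FTC1 R f (BLeft 0).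
have h1 y : mu.-integrable [set` Interval (BLeft 0) (BRight y)] (EFin \o f).
  exact: intg_itv.
have h2 : locally_integrable [set: R] f.
  by have := integrable_locally measurableT fi; rewrite patch_setT.
move=> /(_ h1 h2); apply: filterS.
  exact: (ae_filter_ringOfSetsType mu).
move=> x /= h x0.
have [|d e] := h; first by rewrite lte_fin.
by split=> //; rewrite -derive1E.
Qed.

Lemma prim_is_derive f x : continuous f -> 0 < x ->
  is_derive x (1 : R) (prim f) (f x).
Proof.
move=> cf x0; have xx : x < x + 1 by rewrite ltrDl.
have [|d e] := continuous_FTC1_closed xx (f := f) (a := 0) _ x0 (cf x).
  exact: continuous_intg.
by split=> //; rewrite -derive1E.
Qed.

Lemma approx_continuous b f e : intg `[0, b] f -> 0 < e ->
  exists2 g, continuous g & \int[mu]_(t in `[0, b]) `|f t - g t| < e.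
Proof.
move=> fi e0; have mb : (mu `[0%R, b] < +oo)%E.
  by rewrite /= lebesgue_measure_itv; case: ifPn => //= _; rewrite -EFinD ltry.
have [//|g [cg gi cvg]] := approximation_continuous_integrable _ mb fi.
move: cvg => /fine_cvgP[_ /cvgrPdist_lt/(_ _ e0)[N _ /(_ N)/(_ (leqnn _))]] /=.
rewrite sub0r normrN => h; exists (g N) => //.
by apply: le_lt_trans h; rewrite /Rintegral; exact: ler_norm.
Qed.

End Primitives.

(** * Integration by parts against an integrable function *)

Section IntegrationByParts.
Context {R : realType}.
Local Notation mu := (@lebesgue_measure R).
Local Notation mset := (@measurable _ (measurableTypeR R)).
Local Notation mfun := (@measurable_fun _ _ (measurableTypeR R) R).
Implicit Types (D E : set R) (f g c dc : R -> R) (a b k x y M : R).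

Lemma is_derive_continuous c dc : (forall x, is_derive x (1 : R) c (dc x)) -> continuous c.
Proof.
by move=> cd x; apply/differentiable_continuous/derivable1_diffP; have [] := cd x.
Qed.

Lemma intg_restrict D f : mset D -> intg D f -> intg setT (f \_ D).
Proof.
move=> mD fi; rewrite /intg -restrict_EFin.
by rewrite -integrable_mkcond.
Qed.

Lemma prim_parts_continuous c dc g x : 0 < x -> continuous g ->
  (forall y, is_derive y (1 : R) c (dc y)) -> continuous dc ->
  prim (fun t => dc t * prim g t) x = c x * prim g x - prim (fun t => c t * g t) x.
Proof.
move=> x0 cg cd cdc; have cc := is_derive_continuous cd.
(* [g] need not be integrable on the whole line. Its restriction is, so [prim h] is continuous
   everywhere and agrees with [prim g] up to [x]. *)
pose h := g \_ `[0, x].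
have hi : intg setT h by apply: intg_restrict => //; exact: continuous_intg.
have ch := prim_continuous hi.
have dh y : y \in `]0, x[ -> is_derive y (1 : R) (prim h) (g y).
  rewrite in_itv/= => /andP[y0 yx].
  apply: (near_eq_is_derive (f := prim g)); last exact: prim_is_derive.
  - near=> z; rewrite /h prim_restrict// ltW//.
    by near: z; exact: lt_nbhsl.
have := @Rintegration_by_parts R (prim h) c g dc 0 x x0.
have -> : \int[mu]_(y in `[0, x]) (prim h y * dc y) = prim (fun t => dc t * prim g t) x.
  apply: eq_Rintegral => y; rewrite inE/= in_itv/= => /andP[_ yx].
  by rewrite mulrC /h prim_restrict.
rewrite {1}/h prim_restrict// prim0 mul0r subr0 => ->.
- rewrite [c x * _]mulrC; congr (_ - _).
  by apply: eq_Rintegral => y _; rewrite mulrC.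
- exact: continuous_subspaceT.
- split.
  + by move=> y yx; have [] := dh y yx.
  + by apply/cvg_at_right_filter/ch.
  + by apply/cvg_at_left_filter/ch.
- by move=> y yx; rewrite derive1E; have [] := dh y yx.
- exact: continuous_subspaceT.
- split.
  + by move=> y yx; have [] := cd y.
  + by apply/cvg_at_right_filter/cc.
  + by apply/cvg_at_left_filter/cc.
- by move=> y yx; rewrite derive1E; have [] := cd y.
Unshelve. all: by end_near. Qed.

Lemma primD f g x : intg `[0, x] f -> intg `[0, x] g ->
  prim (fun t => f t + g t) x = prim f x + prim g x.
Proof. by move=> fi gi; exact: RintegralD. Qed.

Lemma prim_sub f g x : intg `[0, x] f -> intg `[0, x] g ->
  prim (fun t => f t - g t) x = prim f x - prim g x.
Proof. by move=> fi gi; exact: RintegralB. Qed.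

Lemma primZ f k x : intg `[0, x] f -> prim (fun t => k * f t) x = k * prim f x.
Proof. exact: RintegralZl. Qed.

Lemma norm_prim_itv f x y : intg setT f -> y <= x ->
  `|prim f y| <= \int[mu]_(t in `[0, x]) `|f t|.
Proof.
move=> fi yx; apply: (@le_trans _ _ (\int[mu]_(t in `[0, y]) `|f t|)).
  by apply: le_normr_Rintegral => //; exact: intg_itv.
apply: Rintegral_sub => //; last by apply: intg_norm; exact: intg_itv.
by apply: subset_itvl; rewrite bnd_simp.
Qed.

Lemma intg_prim a b f : intg setT f -> intg `[a, b] (prim f).
Proof. by move=> fi; apply: continuous_intg; exact: prim_continuous. Qed.

Lemma eq_prim f g x : (forall t, 0 <= t <= x -> f t = g t) -> prim f x = prim g x.
Proof. by move=> fg; apply: eq_Rintegral => t; rewrite inE/= in_itv/=; exact: fg. Qed.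

(** Every term is continuous in [f] for the L^1 norm on [[0, x]], so the formula extends by density
    from continuous functions. *)
Lemma prim_parts c dc f x : 0 <= x -> intg setT f ->
  (forall y, is_derive y (1 : R) c (dc y)) -> continuous dc ->
  prim (fun t => dc t * prim f t) x = c x * prim f x - prim (fun t => c t * f t) x.
Proof.
rewrite le_eqVlt => /predU1P[<- _ _ _|x0 fi cd cdc].
  by rewrite !prim0 mulr0 subr0.
have cc := is_derive_continuous cd.
have [M1 M10 cM1] := continuous_itv_bounded 0 x cc.
have [M2 M20 cM2] := continuous_itv_bounded 0 x cdc.
apply/eqP; rewrite -subr_eq0 -normr_le0; apply/ler_addgt0Pl => e e0; rewrite addr0.
(* [K] collects the errors of the three terms when [f] is replaced by [g]: [M2 * x] for the left
   side, [M1] for each term on the right. The 1 keeps it positive. *)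
pose K := M2 * x + M1 + M1 + 1.
have K0 : 0 < K by rewrite /K; have := mulr_ge0 M20 (ltW x0); lra.
have [|g cg fg] := @approx_continuous R x f _ (intg_itv _ fi) (_ : 0 < e / K).
  exact: divr_gt0.
pose h := g \_ `[0, x].
have hi : intg setT h by apply: intg_restrict => //; exact: continuous_intg.
have hg t : 0 <= t <= x -> h t = g t.
  by move=> tx; rewrite /h patchE mem_set//= in_itv.
have Eh := prim_parts_continuous x0 cg cd cdc.
rewrite -(@eq_prim (fun t => dc t * prim h t) (fun t => dc t * prim g t)) in Eh; last first.
  by move=> t /andP[_ tx]; rewrite /h prim_restrict.
rewrite -(@eq_prim (fun t => c t * h t) (fun t => c t * g t)) in Eh; last by move=> t tx;
  rewrite hg.
rewrite -(@eq_prim h g x hg) in Eh.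
have mc D : mset D -> mfun D c by exact: continuous_mfun.
have mdc D : mset D -> mfun D dc by exact: continuous_mfun.
have icf (u : R -> R) : intg setT u -> intg `[0, x] (fun t => c t * u t).
  move=> ki; apply: (@intgM _ _ _ _ M1) => //; first exact: mc.
  exact: intg_itv.
have idf (u : R -> R) : intg setT u -> intg `[0, x] (fun t => dc t * prim u t).
  move=> ki; apply: (@intgM _ _ _ _ M2) => //; first exact: mdc.
  exact: intg_prim.
pose d t := f t - h t.
have di : intg setT d by exact: intgB.
have dg : \int[mu]_(t in `[0, x]) `|d t| < e / K.
  rewrite (@eq_Rintegral _ _ _ mu _ (fun t => `|f t - g t|))// => t.
  by rewrite inE/= in_itv/= => tx; rewrite /d hg.
have -> : prim (fun t => dc t * prim f t) x -
    (c x * prim f x - prim (fun t => c t * f t) x) =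
    prim (fun t => dc t * prim d t) x - c x * prim d x + prim (fun t => c t * d t) x.
  have -> : prim (fun t => dc t * prim d t) x =
      prim (fun t => dc t * prim f t) x - prim (fun t => dc t * prim h t) x.
    rewrite -prim_sub; [|exact: idf|exact: idf].
    apply: eq_prim => t _; rewrite /d prim_sub ?mulrBr//; exact: intg_itv.
  have -> : prim (fun t => c t * d t) x =
      prim (fun t => c t * f t) x - prim (fun t => c t * h t) x.
    rewrite -prim_sub; [|exact: icf|exact: icf].
    by apply: eq_prim => t _; rewrite /d mulrBr.
  rewrite Eh /d prim_sub; [ring|exact: intg_itv|exact: intg_itv].
set I := \int[mu]_(t in `[0, x]) `|d t| in dg.
have x0x : 0 <= x <= x by rewrite lexx ltW.
have pI t : t <= x -> `|prim d t| <= I by exact: norm_prim_itv.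
have H1 : `|prim (fun t => dc t * prim d t) x| <= M2 * I * (x - 0).
  apply: Rintegral_itv_le; [exact: ltW|exact: idf|] => t /[dup] tx /andP[_ t1].
  by rewrite normrM ler_pM// ?cM2// pI.
have H2 : `|c x * prim d x| <= M1 * I by rewrite normrM ler_pM// ?cM1// pI.
have H3 : `|prim (fun t => c t * d t) x| <= M1 * I.
  rewrite /I -RintegralZl//; last by apply: intg_norm; exact: intg_itv.
  apply: le_norm_Rintegral => //.
  - exact: icf.
  - by apply: intgZ => //; apply: intg_norm; exact: intg_itv.
  - by move=> t /=; rewrite in_itv/= => tx; rewrite normrM ler_wpM2r// cM1.
have I0 : 0 <= I by apply: Rintegral_ge0.
have -> : e = K * (e / K) by rewrite mulrC divfK// gt_eqF.
apply: (@le_trans _ _ (K * I)); last by rewrite ler_pM2l// ltW.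
rewrite /K; apply: (le_trans (ler_normD _ _)).
apply: (le_trans (lerD (ler_normB _ _) (lexx _))).
rewrite subr0 in H1; lra.
Qed.

End IntegrationByParts.

(** * The Riemann-Lebesgue lemma *)

Section RiemannLebesgue.
Context {R : realType}.
Local Notation mu := (@lebesgue_measure R).
Local Notation mfun := (@measurable_fun _ _ (measurableTypeR R) R).

Lemma uniform_continuity_itv (a b : R) (g : R -> R) (e : R) : continuous g -> 0 < e ->
  exists2 d, 0 < d & forall x y, a <= x <= b -> `|x - y| < d -> `|g x - g y| < e.
Proof.
move=> cg e0.
have /compact_near_coveringP := @segment_compact R a b.
move=> /(_ R (0 : R)^'+ (fun d x => forall y, `|x - y| < d -> `|g x - g y| < e) _).
case.
  move=> x _; have e2 : 0 < e / 2 by rewrite divr_gt0.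
  have /cvgrPdist_lt/(_ _ e2) [d/= d0 dP] := cg x.
  exists (ball x (d / 2), [set r : R | r < d / 2]) => /=; first split.
  - by apply/nbhs_ballP; exists (d / 2) => //=; rewrite divr_gt0.
  - by apply: nbhs_right_lt; rewrite divr_gt0.
  move=> [y r] [/= xy rd] z yz; rewrite /ball/= in xy.
  have gy : `|g x - g y| < e / 2 by apply: dP; rewrite /ball/=; lra.
  have gz : `|g x - g z| < e / 2.
    apply: dP; rewrite /ball/= (splitr d) -(subrKA y) (le_lt_trans (ler_normD _ _))// ltrD//.
    by rewrite (lt_le_trans yz) ?ltW.
  rewrite -(subrKA (g x)) (splitr e) (le_lt_trans (ler_normD _ _))// ltrD//.
  by rewrite distrC.
move=> d /= d0 dP; exists (d / 2); first by rewrite divr_gt0.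
move=> x y xab xy; apply: (dP (d / 2)) => //=.
- by rewrite /ball/= sub0r normrN gtr0_norm ?divr_gt0// ltr_pdivrMr// ltr_pMr// ltr1n.
- by rewrite divr_gt0.
Qed.

(** On each cell of length [b / n] the factor [e] has mean zero, so [g] may be replaced by its
    difference from the value at the left end of the cell, which is below [eta]. The cells add up by
    induction. *)
Lemma prim_oscillating (b : R) (g e : R -> R) (n : nat) (eta d : R) :
  0 < b -> continuous g -> continuous e -> (forall x, `|e x| <= 1) ->
  (forall x y, 0 <= x <= b -> `|x - y| < d -> `|g x - g y| < eta) ->
  b / n%:R < d ->
  (forall j, (j <= n)%N -> prim e (j%:R * (b / n%:R)) = 0) ->
  forall j, (j <= n)%N ->
    `|prim (fun t => e t * g t) (j%:R * (b / n%:R))| <= eta * (j%:R * (b / n%:R)).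
Proof.
move=> b0 cg ce e1 gd bd e0; elim=> [_|j IH jn]; first by rewrite mul0r prim0 normr0 mulr0.
set h := b / n%:R in bd IH e0 *.
have n0 : (0 < n)%N by apply: leq_ltn_trans jn.
have h0 : 0 < h by rewrite divr_gt0// ltr0n.
set s := j%:R * h; set t := j.+1%:R * h.
have s0 : 0 <= s by rewrite mulr_ge0 ?ler0n// ltW.
have tE : t = s + h by rewrite /t /s -natr1 mulrDl mul1r.
have st : s <= t by rewrite tE lerDl ltW.
have hn : b = n%:R * h by rewrite /h mulrC divfK// pnatr_eq0 -lt0n.
have tb : t <= b by rewrite hn /t ler_wpM2r ?ler_nat// ltW.
have ceg : continuous (fun t => e t * g t).
  by move=> x; apply: cvgM; [exact: ce|exact: cg].
have Eeg := prim_itvB (continuous_intg _ _ ceg) s0 st.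
have Ee := prim_itvB (continuous_intg _ _ ce) s0 st.
rewrite e0// e0// in Ee; last exact: ltnW.
have ie : intg `]s, t] e.
  by apply: (intgS _ _ _ (continuous_intg s t ce)) => //; exact: subset_itv_oc_cc.
have ieg : intg `]s, t] (fun t => e t * g t).
  by apply: (intgS _ _ _ (continuous_intg s t ceg)) => //; exact: subset_itv_oc_cc.
have -> : prim (fun t => e t * g t) t =
  prim (fun t => e t * g t) s + \int[mu]_(x in `]s, t]) (e x * g x - g s * e x).
  rewrite RintegralB//; last exact: intgZ.
  by rewrite RintegralZl// -Ee subr0 mulr0 subr0 -Eeg addrC subrK.
have eta0 : 0 < eta by have := gd 0 0; rewrite lexx ltW//= !subrr normr0; apply;
  rewrite ?(lt_trans h0).
apply: (le_trans (ler_normD _ _)).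
have -> : eta * t = eta * s + eta * (t - s) by rewrite -mulrDr addrC subrK.
rewrite lerD ?IH ?(ltnW jn)//.
have ig : intg `]s, t] (fun x => e x * g x - g s * e x).
  by apply: intgB => //; exact: intgZ.
have icst : intg `]s, t] (fun=> eta).
  apply: (@intgS _ `[s, t]) => //; first exact: subset_itv_oc_cc.
  by apply: continuous_intg => x; exact: cvg_cst.
apply: (@le_trans _ _ (\int[mu]_(x in `]s, t]) eta)).
  apply: le_norm_Rintegral => // x; rewrite /= in_itv/= => /andP[sx xt].
  rewrite mulrC -mulrBl normrM -[leRHS]mulr1 ler_pM// ltW// gd//.
    by rewrite ltW ?(le_lt_trans s0)//= (le_trans xt).
  rewrite gtr0_norm ?subr_gt0//; lra.
rewrite Rintegral_cst//= lebesgue_measure_itv/= lte_fin.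
by case: ltP => //= ts; rewrite mulr0; apply: mulr_ge0; [exact: ltW|rewrite subr_ge0].
Qed.

(** Oscillation is expressed by mean zero on every cell of the partition into n equal parts. An L^1
    approximation by a continuous function reduces the claim to [prim_oscillating]. *)
Lemma riemann_lebesgue (b : R) (f : R -> R) (e : nat -> R -> R) (eps : R) :
  0 < b -> intg `[0, b] f -> 0 < eps ->
  (forall n, continuous (e n)) -> (forall n x, `|e n x| <= 1) ->
  (forall n j, (j <= n)%N -> prim (e n) (j%:R * (b / n%:R)) = 0) ->
  \forall n \near \oo, `|prim (fun t => e n t * f t) b| <= eps.
Proof.
move=> b0 fi eps0 ce e1 e0.
have [|g cg fg] := approx_continuous fi (_ : 0 < eps / 2); first by rewrite divr_gt0.
have [|d d0 gd] := @uniform_continuity_itv 0 b g (eps / 2 / b) cg.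
  by rewrite !divr_gt0.
near=> n.
have n0 : (0 < n)%N by near: n; exact: nbhs_infty_gt.
have bd : b / n%:R < d.
  rewrite ltr_pdivrMr ?ltr0n// mulrC -ltr_pdivrMr//; near: n; exact: nbhs_infty_gtr.
have := prim_oscillating b0 cg (ce n) (e1 n) gd bd (e0 n) (leqnn n).
rewrite mulrC divfK ?pnatr_eq0 -?lt0n// divfK ?gt_eqF// => H.
have me : mfun `[0, b] (e n) by exact: continuous_mfun.
have gi : intg `[0, b] g by exact: continuous_intg.
have iem u : intg `[0, b] u -> intg `[0, b] (fun t => e n t * u t).
  by move=> ui; apply: (@intgM _ _ _ _ 1).
have -> : prim (fun t => e n t * f t) b =
    prim (fun t => e n t * g t) b + prim (fun t => e n t * (f t - g t)) b.
  rewrite -primD; [|exact: iem|by apply: iem; exact: intgB].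
  by apply: eq_prim => t _; ring.
apply: (le_trans (ler_normD _ _)); rewrite (splitr eps) lerD//.
apply: (@le_trans _ _ (\int[mu]_(t in `[0, b]) `|f t - g t|)); last exact: ltW.
apply: le_norm_Rintegral => //.
- by apply: iem; exact: intgB.
- by apply: intg_norm; exact: intgB.
- by move=> x _; rewrite normrM ler_piMl.
Unshelve. all: by end_near. Qed.

End RiemannLebesgue.

(** * Trigonometric modes: orthogonality and oscillation *)

Section Trigonometry.
Context {R : realType}.
Implicit Types (f g c dc : R -> R) (a b k x y M : R).

Lemma is_derive_add f g x a b : is_derive x (1 : R) f a -> is_derive x (1 : R) g b ->
  is_derive x (1 : R) (fun t => f t + g t) (a + b).
Proof. by move=> ? ?; exact: is_deriveD. Qed.

Lemma is_derive_sub f g x a b : is_derive x (1 : R) f a -> is_derive x (1 : R) g b ->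
  is_derive x (1 : R) (fun t => f t - g t) (a - b).
Proof. by move=> ? ?; exact: is_deriveB. Qed.

Lemma is_derive_mul f g x a b : is_derive x (1 : R) f a -> is_derive x (1 : R) g b ->
  is_derive x (1 : R) (fun t => f t * g t) (a * g x + f x * b).
Proof.
move=> ? ?; apply: (@is_derive_eq _ _ _ (f * g)).
by rewrite /GRing.scale/= addrC [g x * a]mulrC.
Qed.

Lemma is_derive_scale k f x a : is_derive x (1 : R) f a ->
  is_derive x (1 : R) (fun t => k * f t) (k * a).
Proof. by move=> ?; exact: is_deriveZ. Qed.

Lemma is_derive_linear k x : is_derive x (1 : R) (fun t => k * t) k.
Proof. by have := is_derive_scale k (is_derive_id x 1); rewrite mulr1. Qed.

Lemma is_derive_cosM k x : is_derive x (1 : R) (fun t => cos (k * t)) (- (k * sin (k * x))).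
Proof.
have := is_derive1_comp (is_derive_cos (k * x)) (is_derive_linear k x).
by rewrite mulNr mulrC.
Qed.

Lemma is_derive_sinM k x : is_derive x (1 : R) (fun t => sin (k * t)) (k * cos (k * x)).
Proof.
by have := is_derive1_comp (is_derive_sin (k * x)) (is_derive_linear k x); rewrite mulrC.
Qed.

Lemma continuous_cosM k : continuous (fun t => cos (k * t)).
Proof. by apply: is_derive_continuous => x; exact: is_derive_cosM. Qed.

Lemma continuous_sinM k : continuous (fun t => sin (k * t)).
Proof. by apply: is_derive_continuous => x; exact: is_derive_sinM. Qed.

Lemma norm_cos_le1 x : `|cos x| <= 1.
Proof. by rewrite ler_norml cos_geN1 cos_le1. Qed.

Lemma norm_sin_le1 x : `|sin x| <= 1.
Proof. by rewrite ler_norml sin_geN1 sin_le1. Qed.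

Lemma sin_npi n : sin (n%:R * pi) = 0 :> R.
Proof.
elim: n => [|n IH]; first by rewrite mul0r sin0.
by rewrite -natr1 mulrDl mul1r sinDpi IH oppr0.
Qed.

Lemma cos_npi n : cos (n%:R * pi) = (-1) ^+ n :> R.
Proof.
elim: n => [|n IH]; first by rewrite mul0r cos0.
by rewrite -natr1 mulrDl mul1r cosDpi IH exprS mulN1r.
Qed.

Lemma prim_is_deriveE c dc x :
  [/\ forall y, is_derive y (1 : R) c (dc y), continuous dc & 0 <= x] ->
  prim dc x = c x - c 0.
Proof.
move=> [cd cdc]; rewrite le_eqVlt => /predU1P[<-|x0]; first by rewrite prim0 subrr.
have cc := is_derive_continuous cd.
rewrite /prim /Rintegral (@continuous_FTC2 R dc c)//.
- exact: continuous_subspaceT.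
- split.
  + by move=> y yx; have [] := cd y.
  + by apply/cvg_at_right_filter/cc.
  + by apply/cvg_at_left_filter/cc.
- by move=> y yx; rewrite derive1E; have [] := cd y.
Qed.

Section Modes.
Variables (b : R) (n : nat).
Hypotheses (b0 : 0 < b) (n0 : (0 < n)%N).
Let k : R := n%:R * pi / b.

Lemma mode_gt0 : 0 < k.
Proof. by rewrite divr_gt0// mulr_gt0 ?pi_gt0// ltr0n. Qed.

Lemma mode_end : k * b = n%:R * pi.
Proof. by rewrite divfK// gt_eqF. Qed.

Let k0 : k != 0. Proof. by rewrite gt_eqF// mode_gt0. Qed.

Lemma prim_mode_cos2 : prim (fun t => cos (k * t) * cos (k * t)) b = b / 2.
Proof.
rewrite (@prim_is_deriveE (fun t => 2^-1 * t + (2 * k)^-1 * (sin (k * t) * cos (k * t)))).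
- by rewrite mode_end sin_npi !mulr0 sin0 !(mul0r, mulr0, addr0, subr0) mulrC.
- split.
  + move=> y; have D := is_derive_add (is_derive_linear 2^-1 y) (is_derive_scale (2 * k)^-1
      (is_derive_mul (is_derive_sinM k y) (is_derive_cosM k y))).
    apply: (is_derive_eq D); have := cos2Dsin2 (k * y) => h.
    have -> : 2^-1 = 2^-1 * (cos (k * y) ^+ 2 + sin (k * y) ^+ 2) by rewrite h mulr1.
    by field; rewrite k0.
  + by move=> x; apply: cvgM; exact: continuous_cosM.
  + exact: ltW.
Qed.

Lemma prim_mode_sin2 : prim (fun t => sin (k * t) * sin (k * t)) b = b / 2.
Proof.
rewrite (@prim_is_deriveE (fun t => 2^-1 * t - (2 * k)^-1 * (sin (k * t) * cos (k * t)))).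
- by rewrite mode_end sin_npi !mulr0 sin0 !(mul0r, mulr0, subr0) mulrC.
- split.
  + move=> y; have D := is_derive_sub (is_derive_linear 2^-1 y) (is_derive_scale (2 * k)^-1
      (is_derive_mul (is_derive_sinM k y) (is_derive_cosM k y))).
    apply: (is_derive_eq D); have := cos2Dsin2 (k * y) => h.
    have -> : 2^-1 = 2^-1 * (cos (k * y) ^+ 2 + sin (k * y) ^+ 2) by rewrite h mulr1.
    by field; rewrite k0.
  + by move=> x; apply: cvgM; exact: continuous_sinM.
  + exact: ltW.
Qed.

Lemma prim_mode_sincos : prim (fun t => sin (k * t) * cos (k * t)) b = 0.
Proof.
rewrite (@prim_is_deriveE (fun t => (2 * k)^-1 * (sin (k * t) * sin (k * t)))).
- by rewrite mode_end sin_npi !mulr0 sin0 !(mul0r, mulr0, subr0).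
- split.
  + move=> y; have D := is_derive_scale (2 * k)^-1 (is_derive_mul (is_derive_sinM k y)
      (is_derive_sinM k y)).
    by apply: (is_derive_eq D); field; rewrite k0.
  + by move=> x; apply: cvgM; [exact: continuous_sinM|exact: continuous_cosM].
  + exact: ltW.
Qed.

Lemma prim_mode_orthogonal m : m != n ->
  prim (fun t => cos (m%:R * pi / b * t) * cos (k * t)) b = 0.
Proof.
move=> mn; set p := m%:R * pi / b.
have pb : p * b = m%:R * pi by rewrite /p divfK// gt_eqF.
have pk : p - k != 0.
  rewrite /p /k -mulrBl -mulrBl; apply: mulf_neq0; last by rewrite invr_eq0 gt_eqF.
  apply: mulf_neq0; last by rewrite gt_eqF ?pi_gt0.
  by rewrite subr_eq0 eqr_nat.
have pk' : p + k != 0.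
  have p0 : 0 <= p by apply: divr_ge0; [rewrite mulr_ge0 ?pi_ge0|exact: ltW].
  by rewrite gt_eqF// ltr_wpDl// mode_gt0.
rewrite (@prim_is_deriveE (fun t => ((p - k) * (p + k))^-1 *
  ((p * (sin (p * t) * cos (k * t))) - k * (cos (p * t) * sin (k * t))))).
- by rewrite mode_end pb !sin_npi !mulr0 sin0 !(mul0r, mulr0, subr0).
- split.
  + move=> y; have D := is_derive_scale ((p - k) * (p + k))^-1 (is_derive_sub
      (is_derive_scale p (is_derive_mul (is_derive_sinM p y) (is_derive_cosM k y)))
      (is_derive_scale k (is_derive_mul (is_derive_cosM p y) (is_derive_sinM k y)))).
    by apply: (is_derive_eq D); field; rewrite pk pk'.
  + by move=> x; apply: cvgM; exact: continuous_cosM.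
  + exact: ltW.
Qed.

Let node j : (j <= n)%N -> 2 * k * (j%:R * (b / n%:R)) = (2 * j)%:R * pi.
Proof.
move=> jn; have nn : n%:R != 0 :> R by rewrite pnatr_eq0 -lt0n.
have bb : b != 0 by rewrite gt_eqF.
by rewrite natrM /k; field; rewrite nn bb.
Qed.

(** A cell of length [b / n] is exactly one period of cos(2 k t), so the doubled modes satisfy the
    hypothesis of [riemann_lebesgue]. *)
Lemma prim_cell_cos j : (j <= n)%N ->
  prim (fun t => cos (2 * k * t)) (j%:R * (b / n%:R)) = 0.
Proof.
move=> jn; rewrite (@prim_is_deriveE (fun t => (2 * k)^-1 * sin (2 * k * t))).
- by rewrite node// sin_npi !mulr0 sin0 mulr0 subr0.
- split.
  + by move=> y; have D := is_derive_scale (2 * k)^-1 (is_derive_sinM (2 * k) y);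
      apply: (is_derive_eq D); field.
  + exact: continuous_cosM.
  + by apply: mulr_ge0 => //; apply: divr_ge0 => //; exact: ltW.
Qed.

Lemma prim_cell_sin j : (j <= n)%N ->
  prim (fun t => sin (2 * k * t)) (j%:R * (b / n%:R)) = 0.
Proof.
move=> jn; rewrite (@prim_is_deriveE (fun t => - (2 * k)^-1 * cos (2 * k * t))).
- by rewrite node// cos_npi !mulr0 cos0 mulr1 exprM sqrrN expr1n expr1n mulr1 subrr.
- split.
  + by move=> y; have D := is_derive_scale (- (2 * k)^-1) (is_derive_cosM (2 * k) y);
      apply: (is_derive_eq D); field.
  + exact: continuous_sinM.
  + by apply: mulr_ge0 => //; apply: divr_ge0 => //; exact: ltW.
Qed.

End Modes.

(** The double-angle formulas leave cos(2 k t) / 2 and sin(2 k t) / 2, apart from the mean 1/2 of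
    the squared cosine. These limits give the residual coefficients to leading order. *)
Lemma riemann_lebesgue_modes b f eps : 0 < b -> intg `[0, b] f -> 0 < eps ->
  \forall n \near \oo,
    `|prim (fun t => cos (n%:R * pi / b * t) * cos (n%:R * pi / b * t) * f t) b
      - prim f b / 2| <= eps /\
    `|prim (fun t => sin (n%:R * pi / b * t) * cos (n%:R * pi / b * t) * f t) b| <= eps.
Proof.
move=> b0 fi eps0; pose k n : R := n%:R * pi / b.
have c0 n j : (j <= n)%N -> prim (fun t => cos (2 * k n * t)) (j%:R * (b / n%:R)) = 0.
  case: n => [|n]; first by rewrite leqn0 => /eqP ->; rewrite mul0r prim0.
  exact: prim_cell_cos.
have s0 n j : (j <= n)%N -> prim (fun t => sin (2 * k n * t)) (j%:R * (b / n%:R)) = 0.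
  case: n => [|n]; first by rewrite leqn0 => /eqP ->; rewrite mul0r prim0.
  exact: prim_cell_sin.
have C := riemann_lebesgue (e := fun n t => cos (2 * k n * t)) b0 fi eps0
  (fun n => @continuous_cosM _) (fun n x => norm_cos_le1 _) c0.
have S := riemann_lebesgue (e := fun n t => sin (2 * k n * t)) b0 fi eps0
  (fun n => @continuous_sinM _) (fun n x => norm_sin_le1 _) s0.
near=> n; rewrite -/(k n).
have Cn : `|prim (fun t => cos (2 * k n * t) * f t) b| <= eps by near: n.
have Sn : `|prim (fun t => sin (2 * k n * t) * f t) b| <= eps by near: n.
have ic : intg `[0, b] (fun t => cos (2 * k n * t) * f t).
  apply: (@intgM _ _ _ _ 1) => //; last by move=> *; exact: norm_cos_le1.
  exact: (continuous_mfun (@continuous_cosM _)).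
have is_ : intg `[0, b] (fun t => sin (2 * k n * t) * f t).
  apply: (@intgM _ _ _ _ 1) => //; last by move=> *; exact: norm_sin_le1.
  exact: (continuous_mfun (@continuous_sinM _)).
have e2 x : x <= eps -> 2^-1 * x <= eps by move=> xe; lra.
split.
  have -> : prim (fun t => cos (k n * t) * cos (k n * t) * f t) b - prim f b / 2 =
      2^-1 * prim (fun t => cos (2 * k n * t) * f t) b.
    rewrite [prim f b / 2]mulrC /prim -!RintegralZl// -!/(prim _ b) -prim_sub.
    - apply: eq_prim => t _; have := cos2Dsin2 (k n * t) => h.
      have -> : 2 * k n * t = k n * t + k n * t by ring.
      rewrite cosD; have -> : sin (k n * t) * sin (k n * t) = 1 - cos (k n * t) ^+ 2.
        by rewrite -h; ring.
      by field.
    - apply: (@intgM _ _ _ _ 1) => //.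
        apply: (continuous_mfun (f := fun t => cos (k n * t) * cos (k n * t))) => //.
        by move=> x; apply: cvgM; exact: continuous_cosM.
      by move=> x _; rewrite normrM mulr_ile1// norm_cos_le1.
    - exact: intgZ.
  by rewrite normrM gtr0_norm ?e2.
have -> : prim (fun t => sin (k n * t) * cos (k n * t) * f t) b =
    2^-1 * prim (fun t => sin (2 * k n * t) * f t) b.
  rewrite /prim -!RintegralZl// -!/(prim _ b).
  apply: eq_prim => t _; have -> : 2 * k n * t = k n * t + k n * t by ring.
  by rewrite sinD; field.
by rewrite normrM gtr0_norm ?e2.
Unshelve. all: by end_near. Qed.

End Trigonometry.

(** * Quasimodes on an edge *)

Section FixedPoint.
Context {R : realType}.
Local Notation mfun := (@measurable_fun _ _ (measurableTypeR R) R).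

(** Serves both the Picard iteration and the lacunary series. The limit is taken pointwise, which
    preserves measurability. *)
Lemma geometric_uniform_limit (u : nat -> R -> R) (C r : R) :
  0 < r < 1 -> 0 <= C -> (forall n, mfun setT (u n)) ->
  (forall n x, `|u n.+1 x - u n x| <= C * r ^+ n) ->
  exists2 g, mfun setT g & forall n x, `|g x - u n x| <= C / (1 - r) * r ^+ n.
Proof.
move=> /andP[r0 r1] C0 mu_ du.
have r1' : 0 < 1 - r by rewrite subr_gt0.
(* The exact value of the partial geometric sum is what lets the induction on [p] close. *)
have tail n p x : `|u (n + p)%N x - u n x| <= C / (1 - r) * r ^+ n * (1 - r ^+ p).
  elim: p => [|p IH]; first by rewrite addn0 !subrr normr0 mulr0.
  rewrite addnS -(subrKA (u (n + p)%N x)); apply: (le_trans (ler_normD _ _)).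
  apply: (le_trans (lerD (du _ _) IH)).
  rewrite le_eqVlt; apply/orP; left; apply/eqP.
  rewrite exprS exprD; field; rewrite gt_eqF//.
have r0n n : 0 <= r ^+ n by rewrite exprn_ge0// ltW.
have K0 : 0 <= C / (1 - r) by rewrite divr_ge0// ltW.
have tail' n m x : (n <= m)%N -> `|u m x - u n x| <= C / (1 - r) * r ^+ n.
  move=> /subnKC <-; apply: (le_trans (tail _ _ _)).
  by apply: ler_piMr; [exact: mulr_ge0|rewrite gerBl].
have rcvg : (fun n => C / (1 - r) * r ^+ n) @ \oo --> 0.
  rewrite -[X in _ --> X](mulr0 (C / (1 - r))); apply: cvgMr.
  by apply: cvg_expr; rewrite gtr0_norm.
have small e : 0 < e -> \forall n \near \oo, C / (1 - r) * r ^+ n < e.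
  move=> e0; move/cvgrPdist_lt/(_ _ e0): rcvg; apply: filterS => n.
  by rewrite sub0r normrN ger0_norm// mulr_ge0.
have ucvg x : cvgn (fun n => u n x).
  apply/cauchy_cvgP; apply: cauchy_exP => e e0.
  have [N _ NP] := small e e0.
  exists (u N x); exists N => // m /= Nm; rewrite /ball/= distrC.
  by apply: (le_lt_trans (tail' _ _ _ Nm)); exact: (NP N (leqnn N)).
exists (fun x => limn (fun n => u n x)).
  by apply: (measurable_fun_cvg mu_) => x _; exact: ucvg.
move=> n x; apply/ler_addgt0Pl => e e0.
have /cvgrPdist_lt/(_ _ e0) [N _ NP] := ucvg x.
have := NP (maxn N n) (leq_maxl _ _) => /= h1.
have h2 := tail' n (maxn N n) x (leq_maxr _ _).
rewrite -(subrKA (u (maxn N n) x)); apply: (le_trans (ler_normD _ _)).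
by rewrite lerD// ltW.
Qed.

Definition bounded_mfun (f : R -> R) := mfun setT f /\ exists M, forall x, `|f x| <= M.

(** Picard iteration from 0 in the supremum norm: the first step is at most [C], and ratio 1/2 sums
    the steps to [2 * C]. The fixed-point equation holds at every point, not just almost
    everywhere. *)
Lemma contraction_fixed_point (T : (R -> R) -> R -> R) (C : R) :
  0 <= C ->
  (forall f, bounded_mfun f -> bounded_mfun (T f)) ->
  (forall f g (d : R), bounded_mfun f -> bounded_mfun g -> (forall x, `|f x - g x| <= d) ->
    forall x, `|T f x - T g x| <= d / 2) ->
  (forall x, `|T (cst 0) x| <= C) ->
  exists f, [/\ bounded_mfun f, forall x, f x = T f x & forall x, `|f x| <= 2 * C].
Proof.
move=> C0 Tb Tc T0; pose u n := iter n T (cst 0).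
have b0 : bounded_mfun (cst 0).
  by split; [exact: measurable_cst|exists 0 => x; rewrite normr0].
have ub n : bounded_mfun (u n) by elim: n => [//|n IH]; exact: Tb.
have du n x : `|u n.+1 x - u n x| <= C * 2^-1 ^+ n.
  elim: n x => [|n IH] x; first by rewrite expr0 mulr1 subr0; exact: T0.
  rewrite exprSr mulrA; exact: (Tc (u n.+1) (u n) _ (ub _) (ub _) IH x).
have half : 0 < (2^-1 : R) < 1 by rewrite invr_gt0 ltr0n/= invf_lt1 ?ltr1n.
have [g mg gu] := geometric_uniform_limit half C0 (fun n => (ub n).1) du.
have E : C / (1 - 2^-1) = 2 * C by field.
rewrite E in gu.
have g2 x : `|g x| <= 2 * C by have := gu 0%N x; rewrite subr0 expr0 mulr1.
have gb : bounded_mfun g by split=> //; exists (2 * C).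
exists g; split => // x; apply/eqP; rewrite -subr_eq0 -normr_le0.
apply/ler_addgt0Pl => e e0; rewrite addr0.
have /cvgrPdist_lt/(_ (e / (4 * C + 1))) : (fun n => 2^-1 ^+ n : R) @ \oo --> 0.
  by apply: cvg_expr; rewrite gtr0_norm; case/andP: half.
have C1 : 0 < 4 * C + 1 by lra.
case=> [|N _ /(_ N (leqnn N))]; first by rewrite divr_gt0.
rewrite /= sub0r normrN ger0_norm ?exprn_ge0// ltr_pdivlMr// => NP.
rewrite -(subrKA (u N.+1 x)); apply: (le_trans (ler_normD _ _)).
have h1 := gu N.+1 x.
have h2 := Tc _ _ _ gb (ub N) (gu N) x.
rewrite [`|u _ _ - _|]distrC.
have q0 : 0 <= 2^-1 ^+ N :> R by rewrite exprn_ge0.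
rewrite exprSr in h1.
have : `|g x - u N.+1 x| + `|T g x - u N.+1 x| <= 2 * (2 * C * 2^-1 ^+ N / 2) by lra.
move=> /le_trans; apply; move: NP q0 C0; set r := _ ^+ N; nra.
Qed.

End FixedPoint.

(** * Absolutely continuous functions *)

Section AbsoluteContinuity.
Context {R : realType}.
Implicit Types (f g c dc : R -> R) (b M : R).

Lemma eq_abs_continuous b f g : (forall x, 0 <= x <= b -> f x = g x) ->
  abs_continuous b f -> abs_continuous b g.
Proof.
move=> fg fac e e0; have [d d0 dP] := fac e e0; exists d => // n s t st dis sd.
have := dP n s t st dis sd; congr (_ < _); apply: eq_bigr => i _.
have [/andP[s0 sti] tb] := st i.
by rewrite !fg ?s0 ?(le_trans sti) ?(le_trans s0).
Qed.

Lemma abs_continuousD b f g : abs_continuous b f -> abs_continuous b g ->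
  abs_continuous b (fun x => f x + g x).
Proof.
move=> fac gac e e0; have e2 : 0 < e / 2 by rewrite divr_gt0.
have [d d0 dP] := fac _ e2; have [d' d'0 d'P] := gac _ e2.
exists (Num.min d d'); first by rewrite lt_min d0.
move=> n s t st dis; rewrite lt_min => /andP[sd sd'].
have h1 := dP n s t st dis sd; have h2 := d'P n s t st dis sd'.
rewrite (splitr e); apply: le_lt_trans (ltrD h1 h2).
rewrite -big_split; apply: ler_sum => i _ /=.
by rewrite opprD addrACA ler_normD.
Qed.

Lemma abs_continuous_mul_bounded b f g M : 0 <= M -> (forall x, 0 <= x <= b -> `|f x| <= M) ->
  (forall x, 0 <= x <= b -> `|g x| <= M) ->
  abs_continuous b f -> abs_continuous b g -> abs_continuous b (fun x => f x * g x).
Proof.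
move=> M0 fM gM fac gac e e0.
have e2 : 0 < e / (2 * (M + 1)) by rewrite divr_gt0// mulr_gt0// ltr_pwDr.
have [d d0 dP] := fac _ e2; have [d' d'0 d'P] := gac _ e2.
exists (Num.min d d'); first by rewrite lt_min d0.
move=> n s t st dis; rewrite lt_min => /andP[sd sd'].
have h1 := dP n s t st dis sd; have h2 := d'P n s t st dis sd'.
have -> : e = (M + 1) * (e / (2 * (M + 1)) + e / (2 * (M + 1))).
  by field; rewrite gt_eqF// ltr_pwDr.
have M1 : 0 < M + 1 by rewrite ltr_pwDr.
apply: (@le_lt_trans _ _ ((M + 1) * (\sum_(i < n) `|f (t i) - f (s i)| +
   \sum_(i < n) `|g (t i) - g (s i)|))); last by rewrite ltr_pM2l// ltrD.
rewrite -big_split mulr_sumr; apply: ler_sum => i _ /=.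
have [/andP[s0 sti] tb] := st i.
have -> : f (t i) * g (t i) - f (s i) * g (s i) =
  (f (t i) - f (s i)) * g (t i) + f (s i) * (g (t i) - g (s i)) by ring.
apply: (le_trans (ler_normD _ _)); rewrite !normrM.
have h3 : `|g (t i)| <= M + 1 by rewrite ler_wpDr// gM// tb (le_trans s0).
have h4 : `|f (s i)| <= M + 1 by rewrite ler_wpDr// fM// s0 (le_trans sti).
by rewrite mulrDr; apply: lerD; [rewrite mulrC|]; exact: ler_wpM2r.
Qed.

Lemma abs_continuousM b f g : continuous f -> continuous g ->
  abs_continuous b f -> abs_continuous b g -> abs_continuous b (fun x => f x * g x).
Proof.
move=> cf cg; have [M M0 fM] := continuous_itv_bounded 0 b cf.
have [M' M'0 gM] := continuous_itv_bounded 0 b cg.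
apply: (@abs_continuous_mul_bounded _ _ _ (M + M')); first exact: addr_ge0.
- by move=> x xb; rewrite (le_trans (fM x xb))// lerDl.
- by move=> x xb; rewrite (le_trans (gM x xb))// lerDr.
Qed.

Lemma abs_continuous_cst b (k : R) : abs_continuous b (fun=> k).
Proof.
move=> e e0; exists 1 => // n s t _ _ _.
by rewrite big1// => i _; rewrite subrr normr0.
Qed.

Lemma abs_continuous_derive b c dc : (forall y, is_derive y (1 : R) c (dc y)) -> continuous
  dc ->
  abs_continuous b c.
Proof.
move=> cd cdc; have di : intg setT (dc \_ `[0, b]).
  by apply: intg_restrict => //; exact: continuous_intg.
apply: (@eq_abs_continuous _ (fun x => c 0 + prim (dc \_ `[0, b]) x)); last first.
  by apply: abs_continuousD; [exact: abs_continuous_cst|exact: abs_continuous_prim].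
move=> x /andP[x0 xb]; rewrite prim_restrict// (@prim_is_deriveE _ c)//.
by rewrite addrC subrK.
Qed.

End AbsoluteContinuity.

(** * The Volterra equation on one edge *)

Section EdgeEquation.
Context {R : realType}.
Local Notation mu := (@lebesgue_measure R).
Local Notation mset := (@measurable _ (measurableTypeR R)).
Local Notation mfun := (@measurable_fun _ _ (measurableTypeR R) R).

Implicit Types (f g e : R -> R) (d M x t : R).

Variables (b : R) (n : nat) (Q : R -> R) (sg : R).
Hypotheses (b0 : 0 < b) (n0 : (0 < n)%N) (Qi : intg setT Q).
Local Notation k := (n%:R * pi / b).
Local Notation cosk := (fun t => cos (k * t)).
Local Notation sink := (fun t => sin (k * t)).
Let N := \int[mu]_t `|Q t|.
(** [weight] has integral 5 N and enters twice, so the operator has Lipschitz constant 10 N / k, at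
    most 1/2 under the first bound. Under the second, the first iterate is at most 1 + 5 |sg| / k <=
    2, whence the bound 4 on the fixed point. *)
Hypothesis kN : 20 * N <= k.
Hypothesis ksg : 5 * `|sg| <= k.

Let k0 : 0 < k. Proof. exact: mode_gt0. Qed.
Let kb : k * b = n%:R * pi. Proof. exact: mode_end. Qed.
Let N0 : 0 <= N. Proof. by apply: Rintegral_ge0. Qed.
Let cC : continuous cosk. Proof. exact: continuous_cosM. Qed.
Let cS : continuous sink. Proof. exact: continuous_sinM. Qed.
Let C1 x : `|cosk x| <= 1. Proof. exact: norm_cos_le1. Qed.
Let S1 x : `|sink x| <= 1. Proof. exact: norm_sin_le1. Qed.

(* The coefficients of the residual are what makes the source term satisfy
   [int_0^b cos(k t) source = - sg] and [int_0^b sin(k t) source = 0], that is,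
   phi(b) = (-1)^n and phi'(b) = 0. *)
Definition cos_coef f := 2 / b * (prim (fun t => cosk t * (Q t * f t)) b + sg).
Definition sin_coef f := 2 / b * prim (fun t => sink t * (Q t * f t)) b.
Definition residual f t := cos_coef f * cosk t + sin_coef f * sink t.
(** The indicator makes the source integrable on the whole line, which the residual alone need not
    be. *)
Definition source f t := Q t * f t - \1_(`[0, b]%classic) t * residual f t.
(* Variation of constants for [- f'' - k^2 f = - source f], f(0) = 1, f'(0) = sg. *)
Definition volterra f x :=
  cosk x * (1 - prim (fun t => sink t * source f t) x / k) +
  sink x * (sg + prim (fun t => cosk t * source f t) x) / k.

(** The pointwise Lipschitz constant of [source]: [|Q|] comes from the product with the potential,
    and each of the two residual coefficients, with Lipschitz constant 2 N / b, contributes on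
    [[0, b]]. *)
Definition weight t := `|Q t| + 4 / b * N * \1_(`[0, b]%classic) t.

Let mC D : mset D -> mfun D cosk. Proof. exact: continuous_mfun. Qed.
Let mS D : mset D -> mfun D sink. Proof. exact: continuous_mfun. Qed.

Let iC f : intg setT f -> intg setT (fun t => cosk t * f t).
Proof. by move=> fi; apply: (@intgM _ _ _ _ 1) => //; exact: mC. Qed.
Let iS f : intg setT f -> intg setT (fun t => sink t * f t).
Proof. by move=> fi; apply: (@intgM _ _ _ _ 1) => //; exact: mS. Qed.

Lemma intg_indic : intg setT (\1_(`[0, b]%classic) : R -> R).
Proof.
have := @intg_restrict R `[0, b] (fun=> 1) (measurable_itv _).
rewrite -indic_restrict; apply; apply: continuous_intg => x; exact: cvg_cst.
Qed.

Lemma Rintegral_indic : \int[mu]_t (\1_(`[0, b]%classic) t) = b.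
Proof.
rewrite /Rintegral integral_indic//= setIT lebesgue_measure_itv/= lte_fin b0.
by rewrite sube0.
Qed.

Lemma intg_weight : intg setT weight.
Proof. by apply: intgD => //; [exact: intg_norm|apply: intgZ => //; exact: intg_indic]. Qed.

Lemma Rintegral_weight : \int[mu]_t weight t = 5 * N.
Proof.
rewrite RintegralD//; [|exact: intg_norm|by apply: intgZ => //; exact: intg_indic].
rewrite RintegralZl//; last exact: intg_indic.
rewrite Rintegral_indic -/N; field; rewrite gt_eqF//.
Qed.

Lemma intg_Qf f : bounded_mfun f -> intg setT (fun t => Q t * f t).
Proof.
move=> [mf [M fM]].
apply: (@eq_intg _ _ (fun t => f t * Q t)) => //; first by move=> x _; rewrite mulrC.
by apply: (@intgM _ _ _ _ M).
Qed.

Lemma continuous_residual f : continuous (residual f).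
Proof.
by move=> x; apply: cvgD; apply: cvgM; (try exact: cvg_cst); [exact: cC|exact: cS].
Qed.

Lemma intg_source f : bounded_mfun f -> intg setT (source f).
Proof.
move=> fb; apply: intgB => //; first exact: intg_Qf.
have [M M0 rM] := continuous_itv_bounded 0 b (@continuous_residual f).
apply: (@eq_intg _ _ (residual f \_ `[0, b])) => //.
  by move=> x _; rewrite patchE indicE; case: ifPn; rewrite ?mul1r ?mul0r.
apply: intg_restrict => //; apply: continuous_intg; exact: continuous_residual.
Qed.

Lemma bounded_volterra f : bounded_mfun f -> bounded_mfun (volterra f).
Proof.
move=> fb; have fi := intg_source fb; split.
  apply: continuous_mfun => //.
  move=> x; apply: cvgD.
    apply: cvgM; first exact: cC.
    apply: cvgB; first exact: cvg_cst.
    apply: cvgM; last exact: cvg_cst.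
    by apply: prim_continuous; exact: iS.
  apply: cvgM; last exact: cvg_cst.
  apply: cvgM; first exact: cS.
  apply: cvgD; first exact: cvg_cst.
  by apply: prim_continuous; exact: iC.
pose I1 := \int[mu]_t `|sink t * source f t|; pose I2 := \int[mu]_t `|cosk t * source f t|.
exists (1 * (1 + I1 / k) + 1 * (`|sg| + I2) / k) => x.
have I10 : 0 <= I1 by exact: Rintegral_ge0.
have I20 : 0 <= I2 by exact: Rintegral_ge0.
apply: (le_trans (ler_normD _ _)); rewrite !normrM.
rewrite lerD//.
  apply: ler_pM => //; apply: (le_trans (ler_normB _ _)).
  rewrite normr1 lerD2l normrM normfV (gtr0_norm k0) ler_pM2r ?invr_gt0//.
  exact: norm_prim (iS fi).
rewrite normfV (gtr0_norm k0) ler_pM2r ?invr_gt0// ler_pM//.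
by apply: (le_trans (ler_normD _ _)); rewrite lerD2l; exact: norm_prim (iC fi).
Qed.

Lemma coef_bound (e f : R -> R) d : continuous e -> (forall x, `|e x| <= 1) ->
  mfun setT f -> (forall x, `|f x| <= d) ->
  `|prim (fun t => e t * (Q t * f t)) b| <= N * d.
Proof.
move=> ce e1 mf fd; have d0 : 0 <= d by exact: le_trans (fd 0).
have Qf : intg setT (fun t => Q t * f t) by apply: intg_Qf; split=> //; exists d.
have ei : intg setT (fun t => e t * (Q t * f t)).
  by apply: (@intgM _ _ _ _ 1) => //; exact: continuous_mfun.
apply: (le_trans (norm_prim _ ei)); rewrite /N -RintegralZr//; last exact: intg_norm.
apply: le_Rintegral => //; first exact: intg_norm.
  apply: (@eq_intg _ _ (fun t => d * `|Q t|)) => //.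
    by move=> x _; rewrite mulrC.
  by apply: intgZ => //; exact: intg_norm.
move=> x _; rewrite !normrM -[leRHS]mul1r ler_pM// ?mulr_ge0//.
by rewrite ler_pM.
Qed.

Lemma indic_bounds t : 0 <= (\1_(`[0, b]%classic) t : R) <= 1.
Proof. by rewrite indicE; case: (_ \in _); rewrite !lexx !ler01. Qed.

Lemma coef_sub f g : bounded_mfun f -> bounded_mfun g ->
  (cos_coef f - cos_coef g = 2 / b * prim (fun t => cosk t * (Q t * (f t - g t))) b) *
  (sin_coef f - sin_coef g = 2 / b * prim (fun t => sink t * (Q t * (f t - g t))) b).
Proof.
move=> fb gb; split; rewrite -mulrBr; congr (_ * _).
- rewrite opprD addrACA subrr addr0 -prim_sub;
    [|by apply: intg_itv; apply: iC; exact: intg_Qf..].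
  by apply: eq_prim => t _; ring.
- rewrite -prim_sub; [|by apply: intg_itv; apply: iS; exact: intg_Qf..].
  by apply: eq_prim => t _; ring.
Qed.

Lemma source_lipschitz f g d : bounded_mfun f -> bounded_mfun g ->
  (forall x, `|f x - g x| <= d) ->
  forall t, `|source f t - source g t| <= d * weight t.
Proof.
move=> fb gb fgd t; have d0 : 0 <= d by exact: le_trans (fgd 0).
have mfg : mfun setT (fun x => f x - g x) by apply: measurable_funB; [case: fb|case: gb].
have hA := coef_bound cC C1 mfg fgd; have hB := coef_bound cS S1 mfg fgd.
have /andP[i0 i1] := indic_bounds t; set I := \1_ _ t in i0 i1 *.
have -> : source f t - source g t = Q t * (f t - g t) -
  I * ((cos_coef f - cos_coef g) * cosk t + (sin_coef f - sin_coef g) * sink t).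
  by rewrite /source /residual -/I; ring.
rewrite !coef_sub//; apply: (le_trans (ler_normB _ _)); rewrite /weight -/I [leRHS]mulrDr.
apply: lerD; first by rewrite normrM mulrC ler_wpM2r.
have -> : d * (4 / b * N * I) = I * (2 / b * (N * d) * 1 + 2 / b * (N * d) * 1) by ring.
rewrite normrM (ger0_norm i0) ler_wpM2l//; apply: (le_trans (ler_normD _ _)).
have b2 : 0 <= 2 / b by rewrite divr_ge0// ltW.
move: (2 / b) b2 => c2 b2.
by apply: lerD; rewrite !normrM (ger0_norm b2) ler_pM ?mulr_ge0// ler_pM.
Qed.

Let z0 (e : R -> R) : prim (fun t => e t * (Q t * cst 0 t)) b = 0.
Proof.
rewrite (@eq_prim _ _ (fun=> 0)) => [|u _]; last by rewrite /= !mulr0.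
by rewrite /prim Rintegral_cst//= mul0r.
Qed.

Let bm0 : bounded_mfun (cst (0 : R)).
Proof. by split; [exact: measurable_cst|exists 0 => x; rewrite normr0]. Qed.

Lemma source0 t : `|source (cst 0) t| <= 2 * `|sg| / b * \1_(`[0, b]%classic) t.
Proof.
have /andP[i0 i1] := indic_bounds t; have b2 : 0 <= 2 / b by rewrite divr_ge0// ltW.
have -> : 2 * `|sg| / b = 2 / b * `|sg| by ring.
rewrite /source /residual /cos_coef /sin_coef !z0; set I := \1_ _ t in i0 i1 *.
move: (2 / b) b2 => c2 b2.
rewrite /= mulr0 sub0r normrN normrM (ger0_norm i0) mulrC ler_wpM2r// add0r mulr0 mul0r addr0.
by rewrite !normrM -[leRHS]mulr1 ler_pM// (ger0_norm b2).
Qed.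

(** The source is affine in [f]: its linear part costs at most 5 N M, and its value at 0 is a cosine
    on [[0, b]] with integral at most 2 |sg|. *)
Lemma norm_prim_source e f M x : continuous e -> (forall x, `|e x| <= 1) ->
  bounded_mfun f -> (forall x, `|f x| <= M) ->
  `|prim (fun t => e t * source f t) x| <= 5 * N * M + 2 * `|sg|.
Proof.
move=> ce e1 fb fM; have fi := intg_source fb.
have ei : intg setT (fun t => e t * source f t).
  by apply: (@intgM _ _ _ _ 1) => //; exact: continuous_mfun.
apply: (le_trans (norm_prim _ ei)).
have -> : 5 * N * M + 2 * `|sg| =
    \int[mu]_t (M * weight t + 2 * `|sg| / b * \1_(`[0, b]%classic) t).
  rewrite RintegralD//; [|by apply: intgZ => //; exact: intg_weight
                         |by apply: intgZ => //; exact: intg_indic].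
  rewrite !RintegralZl//; [|exact: intg_indic|exact: intg_weight].
  by rewrite Rintegral_weight Rintegral_indic; field; rewrite gt_eqF.
apply: le_Rintegral => //; first exact: intg_norm.
  by apply: intgD => //; apply: intgZ => //; [exact: intg_weight|exact: intg_indic].
move=> t _; rewrite normrM -[leRHS]mul1r ler_pM//.
rewrite -(subrK (source (cst 0) t) (source f t)); apply: (le_trans (ler_normD _ _)).
by apply: lerD; [apply: source_lipschitz => // y; rewrite subr0|exact: source0].
Qed.

Lemma prim_source_lipschitz e f g d x : continuous e -> (forall x, `|e x| <= 1) ->
  bounded_mfun f -> bounded_mfun g -> (forall x, `|f x - g x| <= d) ->
  `|prim (fun t => e t * source f t) x - prim (fun t => e t * source g t) x| <= 5 * N * d.
Proof.
move=> ce e1 fb gb fgd; have fi := intg_source fb; have gi := intg_source gb.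
have me : mfun setT e by exact: continuous_mfun.
have ie u : intg setT u -> intg setT (fun t => e t * u t).
  by move=> ui; apply: (@intgM _ _ _ _ 1).
rewrite -prim_sub; [|by apply: intg_itv; exact: ie..].
rewrite (@eq_prim _ _ (fun t => e t * (source f t - source g t))) => [|t _]; last by ring.
have di : intg setT (fun t => e t * (source f t - source g t)) by apply/ie/intgB.
apply: (le_trans (norm_prim _ di)).
rewrite mulrC -Rintegral_weight -RintegralZl//; last exact: intg_weight.
apply: le_Rintegral => //; [exact: intg_norm|by apply: intgZ => //; exact: intg_weight|].
move=> t _; rewrite normrM -[leRHS]mul1r ler_pM//; exact: source_lipschitz.
Qed.

Lemma volterra_contraction f g d : bounded_mfun f -> bounded_mfun g ->
  (forall x, `|f x - g x| <= d) -> forall x, `|volterra f x - volterra g x| <= d / 2.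
Proof.
move=> fb gb fgd x; have d0 : 0 <= d by exact: le_trans (fgd 0).
have hS := prim_source_lipschitz x cS S1 fb gb fgd.
have hC := prim_source_lipschitz x cC C1 fb gb fgd.
rewrite /volterra.
set Sf := prim _ x in hS *; set Sg := prim _ x in hS *.
set Cf := prim _ x in hC *; set Cg := prim _ x in hC *.
have -> : cosk x * (1 - Sf / k) + sink x * (sg + Cf) / k -
    (cosk x * (1 - Sg / k) + sink x * (sg + Cg) / k) =
    (sink x * (Cf - Cg) - cosk x * (Sf - Sg)) / k.
  by move: (k) (gt_eqF k0) => r r0; field; rewrite r0.
rewrite normrM normfV (gtr0_norm k0) ler_pdivrMr//.
apply: (@le_trans _ _ (1 * (5 * N * d) + 1 * (5 * N * d))).
  by apply: (le_trans (ler_normB _ _)); apply: lerD; rewrite normrM ler_pM.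
by move: kN; rewrite -subr_ge0 => kN'; have := mulr_ge0 d0 kN'; lra.
Qed.

Lemma volterra_solution :
  exists f, [/\ bounded_mfun f, forall x, f x = volterra f x & forall x, `|f x| <= 4].
Proof.
have [|f [fb fE f4]] := contraction_fixed_point (ler0n _ 2) bounded_volterra
  volterra_contraction.
  move=> x; rewrite /volterra.
  have z1 (y : R) : `|cst (0 : R) y| <= 0 by rewrite normr0.
  have := norm_prim_source x cS S1 bm0 z1; have := norm_prim_source x cC C1 bm0 z1.
  move: (prim _ x) (prim _ x) => Sf Cf; rewrite mulr0 add0r => hC hS.
  apply: (le_trans (ler_normD _ _)).
  have -> : (2 : R) = 1 * (1 + 2 * `|sg| / k) + 1 * (`|sg| + 2 * `|sg|) / k + (k - 5 *
    `|sg|) / k.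
    by move: (k) (gt_eqF k0) => r r0; field; rewrite r0.
  rewrite ler_wpDr//; first by rewrite divr_ge0 ?subr_ge0// ltW.
  apply: lerD; rewrite normrM.
    apply: ler_pM => //; apply: (le_trans (ler_normB _ _)).
    by rewrite normr1 lerD2l normrM normfV (gtr0_norm k0) ler_pM2r ?invr_gt0.
  rewrite normrM normfV (gtr0_norm k0) ler_pM2r ?invr_gt0//; apply: ler_pM => //.
  by apply: (le_trans (ler_normD _ _)); rewrite lerD2l.
by exists f; split => // x; rewrite (le_trans (f4 x))//; lra.
Qed.

Section Solution.
Variable f : R -> R.
Hypotheses (fb : bounded_mfun f) (fE : forall x, f x = volterra f x)
  (f4 : forall x, `|f x| <= 4).
Local Notation S := (prim (fun t => sink t * source f t)).
Local Notation C := (prim (fun t => cosk t * source f t)).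

(** The formal derivative of [volterra f]: the two terms produced by differentiating the integrals
    cancel. It is continuous although the source is only integrable. *)
Definition dsolution x := - (k * sink x) + sg * cosk x + (sink x * S x + cosk x * C x).

Let fi : intg setT (source f). Proof. exact: intg_source. Qed.
Let contS : continuous S. Proof. by apply: prim_continuous; exact: iS. Qed.
Let contC : continuous C. Proof. by apply: prim_continuous; exact: iC. Qed.

Lemma solution_near_cos x : `|f x - cosk x| <= (40 * N + 5 * `|sg|) / k.
Proof.
have := norm_prim_source x cS S1 fb f4; have := norm_prim_source x cC C1 fb f4.
rewrite fE /volterra /=; move: (prim _ x) (prim _ x) => Sf Cf hC hS.
have -> : cosk x * (1 - Sf / k) + sink x * (sg + Cf) / k - cosk x =
  (sink x * (sg + Cf) - cosk x * Sf) / k.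
  by move: (k) (gt_eqF k0) => r r0; field; rewrite r0.
rewrite normrM normfV (gtr0_norm k0) ler_pM2r ?invr_gt0//.
have -> : 40 * N + 5 * `|sg| = 1 * (`|sg| + (5 * N * 4 + 2 * `|sg|)) +
  1 * (5 * N * 4 + 2 * `|sg|) by ring.
apply: (le_trans (ler_normB _ _)); apply: lerD; rewrite normrM ler_pM//.
by apply: (le_trans (ler_normD _ _)); rewrite lerD2l.
Qed.

Lemma prim_source_end e : continuous e -> (forall x, `|e x| <= 1) ->
  prim (fun t => e t * source f t) b = prim (fun t => e t * (Q t * f t)) b -
   (cos_coef f * prim (fun t => e t * cosk t) b + sin_coef f * prim (fun t => e t * sink t) b).
Proof.
move=> ce e1.
have iQ : intg `[0, b] (fun t => e t * (Q t * f t)).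
  apply: intg_itv; apply: (@intgM _ _ _ _ 1) => //; first exact: continuous_mfun.
  exact: intg_Qf.
have ic u : continuous u -> intg `[0, b] (fun t => e t * u t).
  by move=> cu; apply: continuous_intg => x; apply: cvgM; [exact: ce|exact: cu].
have iec := ic _ cC; have ies := ic _ cS.
rewrite /prim -!RintegralZl//.
rewrite -RintegralD//; [|exact: intgZ..].
rewrite -RintegralB//; last by apply: intgD => //; exact: intgZ.
apply: eq_Rintegral => t; rewrite inE/= => tb.
by rewrite /source /residual indicE mem_set// mul1r; ring.
Qed.

Let bb2 x : 2 / b * x * (b / 2) = x. Proof. by field; rewrite gt_eqF. Qed.

Lemma prim_sin_end : S b = 0.
Proof.
rewrite (prim_source_end cS S1) prim_mode_sincos// prim_mode_sin2// mulr0 add0r.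
by rewrite /sin_coef bb2 subrr.
Qed.

Lemma prim_cos_end : C b = - sg.
Proof.
rewrite (prim_source_end cC C1) prim_mode_cos2//.
rewrite (@eq_prim _ (fun t => cosk t * sink t) (fun t => sink t * cosk t)) => [|t _];
  last first.
  by rewrite mulrC.
rewrite prim_mode_sincos// mulr0 addr0 /cos_coef bb2; ring.
Qed.

Lemma solution0 : f 0 = 1.
Proof. by rewrite fE /volterra !prim0 mulr0 cos0 sin0 !mul0r subr0 mulr1 addr0. Qed.

Lemma solution_end : f b = (-1) ^+ n.
Proof.
by rewrite fE /volterra prim_sin_end kb cos_npi sin_npi !mul0r subr0 mulr1 addr0.
Qed.

Lemma dsolution0 : dsolution 0 = sg.
Proof. by rewrite /dsolution !prim0 !mulr0 cos0 sin0 mulr0 oppr0 mulr1 !addr0 add0r. Qed.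

Lemma dsolution_end : dsolution b = 0.
Proof.
by rewrite /dsolution prim_sin_end prim_cos_end kb cos_npi sin_npi; ring.
Qed.

Lemma continuous_dsolution : continuous dsolution.
Proof.
move=> x; apply: cvgD.
  apply: cvgD; first by apply: cvgN; apply: cvgM; [exact: cvg_cst|exact: cS].
  by apply: cvgM; [exact: cvg_cst|exact: cC].
by apply: cvgD; apply: cvgM; [exact: cS|exact: contS|exact: cC|exact: contC].
Qed.

(** The source is only integrable, so the derivative is identified by integration: parts are taken
    against [S] and [C], and the two leftover integrals, both multiples of [prim w], cancel. That
    [f] is C^1 for positive [x] then follows. *)
Lemma prim_dsolution x : 0 <= x -> f x = 1 + prim dsolution x.
Proof.
move=> x0; rewrite /dsolution.
have cM (g h : R -> R) : continuous g -> continuous h -> continuous (fun t => g t * h t).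
  by move=> cg ch y; apply: cvgM; [exact: cg|exact: ch].
have cD (g h : R -> R) : continuous g -> continuous h -> continuous (fun t => g t + h t).
  by move=> cg ch y; apply: cvgD; [exact: cg|exact: ch].
have cst_ r : continuous (fun _ : R => r : R) by move=> y; exact: cvg_cst.
have c1 : continuous (fun t => - (k * sink t) + sg * cosk t).
  apply: cD; last exact: cM.
  by move=> y; apply: cvgN; exact: (cM _ _ (cst_ k) cS y).
have c2 := cM _ _ cS contS; have c3 := cM _ _ cC contC.
rewrite primD; [|exact: (continuous_intg _ _ c1)|exact: (continuous_intg _ _ (cD _ _ c2 c3))].
rewrite (@primD _ (fun t => sink t * S t) (fun t => cosk t * C t));
  [|exact: (continuous_intg _ _ c2)|exact: (continuous_intg _ _ c3)].
rewrite (@prim_is_deriveE _ (fun t => cosk t + sg / k * sink t)); last first.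
  split=> // y; apply: (is_derive_eq (is_derive_add (is_derive_cosM k y) (is_derive_scale
    (sg / k) (is_derive_sinM k y)))).
  by congr (_ + _); rewrite mulrA divfK// gt_eqF.
have dc1 y : is_derive y (1 : R) (fun t => - k^-1 * cosk t) (sink y).
  by apply: (is_derive_eq (is_derive_scale (- k^-1) (is_derive_cosM k y)));
    rewrite mulrNN mulrA mulVf ?mul1r// gt_eqF.
have dc2 y : is_derive y (1 : R) (fun t => k^-1 * sink t) (cosk y).
  by apply: (is_derive_eq (is_derive_scale k^-1 (is_derive_sinM k y)));
    rewrite mulrA mulVf ?mul1r// gt_eqF.
rewrite (prim_parts x0 (iS fi) dc1 cS) (prim_parts x0 (iC fi) dc2 cC).
pose w t := sink t * (cosk t * source f t).
have wi : intg `[0, x] w by apply: intg_itv; apply: iS; exact: iC.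
rewrite (@eq_prim _ (fun t => - k^-1 * cosk t * (sink t * source f t)) (fun t => - k^-1 * w
  t));
  last by move=> t _; rewrite /w; ring.
rewrite (@eq_prim _ (fun t => k^-1 * sink t * (cosk t * source f t)) (fun t => k^-1 * w t));
  last by move=> t _; rewrite /w; ring.
rewrite !primZ// fE /volterra !mulr0 cos0 sin0; ring.
Qed.

Lemma is_derive_solution x : 0 < x -> is_derive x (1 : R) f (dsolution x).
Proof.
move=> x0; apply: (@near_eq_is_derive _ _ _ (fun y => 1 + prim dsolution y)).
  near=> y; rewrite prim_dsolution// ltW//; near: y; exact: lt_nbhsr.
have D1 : is_derive x (1 : R) (fun=> 1 : R) 0 by exact: is_derive_cst.
apply: (is_derive_eq (is_derive_add D1 (prim_is_derive continuous_dsolution x0))).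
by rewrite add0r.
Unshelve. all: by end_near. Qed.

Lemma abs_continuous_solution : abs_continuous b f.
Proof.
apply: (@eq_abs_continuous _ _ (fun x => 1 + prim (dsolution \_ `[0, b]) x)).
  by move=> x /andP[x0 xb]; rewrite prim_restrict// -prim_dsolution.
apply: abs_continuousD; first exact: abs_continuous_cst.
by apply/abs_continuous_prim/intg_restrict => //; apply: continuous_intg;
  exact: continuous_dsolution.
Qed.

Lemma abs_continuous_dsolution : abs_continuous b dsolution.
Proof.
have csin : continuous (fun y => k * cosk y).
  by move=> y; apply: cvgM; [exact: cvg_cst|exact: cC].
have ccos : continuous (fun y => - (k * sink y)).
  by move=> y; apply: cvgN; apply: cvgM; [exact: cvg_cst|exact: cS].
have aS : abs_continuous b sink by exact: (@abs_continuous_derive R b sink (fun y => k *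
  cosk y) (is_derive_sinM k) csin).
have aC : abs_continuous b cosk by exact: (@abs_continuous_derive R b cosk (fun y => - (k *
  sink y)) (is_derive_cosM k) ccos).
have cst_ r : continuous (fun _ : R => r : R) by move=> y; exact: cvg_cst.
apply: abs_continuousD; last first.
  apply: abs_continuousD; apply: abs_continuousM => //; apply: abs_continuous_prim;
    [exact: iS|exact: iC].
apply: abs_continuousD.
  apply: (@eq_abs_continuous _ _ (fun y => (- k) * sink y)); first by move=> y _;
    rewrite mulNr.
  by apply: abs_continuousM => //; exact: abs_continuous_cst.
by apply: abs_continuousM => //; exact: abs_continuous_cst.
Qed.

Lemma ae_derive_dsolution : {ae mu, forall x, 0 < x < b ->
  is_derive x (1 : R) dsolution (Q x * f x - k ^+ 2 * f x - residual f x)}.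
Proof.
have aS := prim_ae_derive (iS fi); have aC := prim_ae_derive (iC fi).
apply: filterS2 aS aC; first exact: (ae_filter_ringOfSetsType mu).
move=> x hS hC /andP[x0 xb].
have D := is_derive_add (is_derive_add (is_deriveN (is_derive_scale k (is_derive_sinM k
  x))) (is_derive_scale sg (is_derive_cosM k x)))
  (is_derive_add (is_derive_mul (is_derive_sinM k x) (hS x0)) (is_derive_mul
    (is_derive_cosM k x) (hC x0))).
apply: (is_derive_eq D); rewrite /=.
have -> : source f x = Q x * f x - residual f x.
  by rewrite /source indicE mem_set ?mul1r//= in_itv/= !ltW.
have h := cos2Dsin2 (k * x).
rewrite [in RHS]addrAC; set X := Q x * f x - residual f x.
rewrite [f x in RHS]fE /volterra; move: (S x) (C x) => Sx Cx.
have hX : X * (cos (k * x) ^+ 2 + sin (k * x) ^+ 2) = X by rewrite h mulr1.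
rewrite -{3}hX.
by move: (k) (gt_eqF k0) => r r0; field; rewrite r0.
Qed.

End Solution.

End EdgeEquation.

(** * Small residuals at high frequency *)

Section EdgeQuasimode.
Context {R : realType}.
Local Notation mu := (@lebesgue_measure R).
Local Notation mset := (@measurable _ (measurableTypeR R)).
Local Notation mfun := (@measurable_fun _ _ (measurableTypeR R) R).

Record edge_mode (b : R) (q : R -> R) (lam eps : R) (f df h : R -> R) : Prop := EdgeMode {
  em_bounded : bounded_mfun f;
  em_ac : abs_continuous b f;
  em_derive : forall x, 0 < x < b -> is_derive x (1 : R) f (df x);
  em_ac' : abs_continuous b df;
  em_derive2 : {ae mu, forall x, 0 < x < b ->
    is_derive x (1 : R) df (q x * f x - lam * f x - h x)};
  em_continuous : continuous h;
  em_small : forall x, `|h x| <= eps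
}.


(** Testing the equation with cos(k x) and using phi'(b) = 0 gives int h cos = phi'(0) + int (q - s)
    phi cos. As phi is close to cos(k x) and the squared cosine has mean 1/2, the last integral is
    close to (int q - s b) / 2. The prescribed phi'(0) is therefore, to leading order, the only one
    compatible with a small residual. The threshold for n is uniform in [s], because the shifts get
    chosen after n. *)
Lemma edge_quasimode (b : R) (q : R -> R) (M eps : R) :
  0 < b -> intg `[0, b] q -> 0 < eps -> 
  \forall n \near \oo, forall s, `|s| <= M -> exists f df h,
    [/\ edge_mode b q ((n%:R * pi / b) ^+ 2 + s) eps f df h,
        forall x, `|f x - cos (n%:R * pi / b * x)| <= eps,
        f 0 = 1 /\ f b = (-1) ^+ n &
        df 0 = (s * b - prim q b) / 2 /\ df b = 0].
Proof.
move=> b0 qi eps0.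
have [M0|M0] := ltP M 0.
  by near=> n => s sM; have := le_lt_trans sM M0; rewrite normr_lt0.
(* [Nb] and [sb] bound the L^1 norm of [q - s] and the initial slope for all admissible [s] at
   once. *)
pose Nb : R := \int[mu]_(t in `[0, b]) `|q t| + M * b.
pose sb : R := (M * b + `|prim q b|) / 2.
have Nb0 : 0 <= Nb.
  by apply: addr_ge0; [apply: Rintegral_ge0|apply: mulr_ge0; last exact: ltW].
have sb0 : 0 <= sb by rewrite divr_ge0// addr_ge0//; apply: mulr_ge0; last exact: ltW.
(* Replacing [f] by the cosine in a residual coefficient costs [Nb * del], at most eps b / 8. The
   Riemann-Lebesgue error is also eps b / 8, so after the factor 2 / b each coefficient is at most
   eps / 2. *)
pose del : R := Num.min eps (eps * b / (8 * (Nb + 1))).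
have Nb1 : 0 < 8 * (Nb + 1) by rewrite mulr_gt0// ltr_pwDr.
have del0 : 0 < del by rewrite lt_min eps0 divr_gt0// mulr_gt0.
have dele : del <= eps by rewrite ge_min lexx.
have delN : Nb * del <= eps * b / 8.
  apply: (@le_trans _ _ ((Nb + 1) * (eps * b / (8 * (Nb + 1))))).
    by apply: ler_pM => //; [exact: ltW|rewrite lerDl|rewrite ge_min lexx orbT].
  by rewrite le_eqVlt; apply/orP; left; apply/eqP; field; rewrite gt_eqF// ltr_pwDr.
have eta0 : 0 < eps * b / 8 by rewrite divr_gt0// mulr_gt0.
have RL := riemann_lebesgue_modes b0 qi eta0.
near=> n => s sM.
have [RLc RLs] : `|prim (fun t => cos (n%:R * pi / b * t) * cos (n%:R * pi / b * t) * q t) b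
      - prim q b / 2| <= eps * b / 8 /\
    `|prim (fun t => sin (n%:R * pi / b * t) * cos (n%:R * pi / b * t) * q t) b| <= eps * b
      / 8.
  by near: n.
have n0 : (0 < n)%N by near: n; exact: nbhs_infty_gt.
have big r : r * b / pi <= n%:R -> r <= n%:R * pi / b :> R.
  by rewrite ler_pdivrMr ?pi_gt0// -ler_pdivlMr.
have k1 : 20 * Nb <= n%:R * pi / b by apply: big; near: n; exact: nbhs_infty_ger.
have k2 : 5 * sb <= n%:R * pi / b by apply: big; near: n; exact: nbhs_infty_ger.
have k3 : (40 * Nb + 5 * sb) / del <= n%:R * pi / b.
  by apply: big; near: n; exact: nbhs_infty_ger.
(* The shift is absorbed into the potential, so that the frequency stays exactly n pi / b. *)
pose Q := (fun t => q t - s) \_ `[0, b].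
have cq : intg `[0, b] (fun t => q t - s).
  by apply: intgB => //; apply: continuous_intg => x; exact: cvg_cst.
have Qi : intg setT Q by exact: intg_restrict.
pose N := \int[mu]_t `|Q t|.
have NE : N <= Nb.
  rewrite /N /Nb; have -> : \int[mu]_t `|Q t| = \int[mu]_(t in `[0, b]) `|q t - s|.
    rewrite [RHS]Rintegral_mkcond; apply: eq_Rintegral => t _.
    by rewrite /Q !patchE; case: ifP => //; rewrite normr0.
  have -> : M * b = \int[mu]_(t in `[0, b]) M.
    rewrite Rintegral_cst//= lebesgue_measure_itv/= lte_fin b0.
    by rewrite sube0.
  have Mi : intg `[0, b] (fun=> M) by apply: continuous_intg => x; exact: cvg_cst.
  rewrite -RintegralD//; last exact: intg_norm.
  apply: le_Rintegral => //; first exact: intg_norm.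
    by apply: intgD => //; exact: intg_norm.
  by move=> t _; apply: (le_trans (ler_normB _ _)); rewrite lerD2l.
pose sg := (s * b - prim q b) / 2.
have sgE : `|sg| <= sb.
  rewrite /sg /sb normrM [`|2^-1|]gtr0_norm// ler_pM2r//.
  apply: (le_trans (ler_normB _ _)); rewrite lerD2r normrM (gtr0_norm b0).
  by rewrite ler_wpM2r// ltW.
have kN : 20 * N <= n%:R * pi / b by apply: (le_trans _ k1); rewrite ler_pM2l.
have ks : 5 * `|sg| <= n%:R * pi / b by apply: (le_trans _ k2); rewrite ler_pM2l.
have k0 : 0 < n%:R * pi / b :> R by exact: mode_gt0.
have [f [fb fE f4]] := volterra_solution b0 n0 Qi kN ks.
have near_cos x : `|f x - cos (n%:R * pi / b * x)| <= del.
  apply: (le_trans (solution_near_cos b0 n0 Qi fb fE f4 x)).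
  rewrite ler_pdivrMr// [del * _]mulrC -ler_pdivrMr//; apply: (le_trans _ k3).
  by rewrite ler_pM2r ?invr_gt0// lerD// ler_pM2l.
exists f, (dsolution b n Q sg f), (residual b n Q sg f); split.
- split.
  + exact: fb.
  + exact: abs_continuous_solution fb fE.
  + by move=> x /andP[x0 _]; exact: is_derive_solution fb fE _ x0.
  + exact: abs_continuous_dsolution fb.
  + have := ae_derive_dsolution b0 n0 Qi fb fE; apply: filterS.
      exact: (ae_filter_ringOfSetsType mu).
    move=> x h xb; apply: (is_derive_eq (h xb)).
    rewrite /Q patchE mem_set; first by ring.
    by move: xb => /andP[x0 x1]; rewrite /= in_itv/= !ltW.
  + exact: continuous_residual.
  + move=> x; rewrite /residual /cos_coef /sin_coef.
    pose ck t := cos (n%:R * pi / b * t); pose sk t := sin (n%:R * pi / b * t).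
    have cc : continuous ck by exact: continuous_cosM.
    have cs : continuous sk by exact: continuous_sinM.
    have c1 t : `|ck t| <= 1 by exact: norm_cos_le1.
    have s1 t : `|sk t| <= 1 by exact: norm_sin_le1.
    (* Once [f] is replaced by the cosine, the potential separates into [q] and the constant [s],
       whose contributions are known. *)
    have split_f (e : R -> R) : continuous e -> (forall t, `|e t| <= 1) ->
        `|prim (fun t => e t * (Q t * f t)) b -
          (prim (fun t => e t * ck t * q t) b - s * prim (fun t => e t * ck t) b)| <= eps *
            b / 8.
      move=> ce e1.
      have mfc : mfun setT (fun t => f t - ck t).
        by apply: measurable_funB; [case: fb|exact: continuous_mfun].
      have me D : mset D -> mfun D e by exact: continuous_mfun.
      have mec D : mset D -> mfun D (fun t => e t * ck t).
        by apply: continuous_mfun => t; apply: cvgM; [exact: ce|exact: cc].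
      have Qu (u : R -> R) : bounded_mfun u -> intg setT (fun t => e t * (Q t * u t)).
        by move=> ub; apply: (@intgM _ _ _ _ 1) => //; [exact: me|exact: intg_Qf].
      have cb : bounded_mfun ck by split; [exact: continuous_mfun|exists 1].
      have -> : prim (fun t => e t * ck t * q t) b - s * prim (fun t => e t * ck t) b =
          prim (fun t => e t * (Q t * ck t)) b.
        rewrite -primZ; last first.
          by apply: continuous_intg => t; apply: cvgM; [exact: ce|exact: cc].
        rewrite -prim_sub.
        - apply: eq_prim => t tb; rewrite /Q patchE mem_set; first by ring.
          by rewrite /= in_itv.
        - apply: (@intgM _ _ _ _ 1) => //; first exact: mec.
          by move=> t _; rewrite normrM mulr_ile1.
        - apply: intgZ => //; apply: continuous_intg => t.
          by apply: cvgM; [exact: ce|exact: cc].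
      rewrite -prim_sub; [|by apply: intg_itv; exact: Qu..].
      rewrite (@eq_prim _ _ (fun t => e t * (Q t * (f t - ck t)))) => [|t _]; last by ring.
      apply: (le_trans (coef_bound b Qi ce e1 mfc near_cos)).
      by apply: le_trans delN; rewrite ler_pM2r.
    have hA := split_f _ cc c1; have hB := split_f _ cs s1.
    rewrite prim_mode_cos2// in hA; rewrite prim_mode_sincos// mulr0 subr0 in hB.
    have b2 : 0 <= 2 / b by rewrite divr_ge0// ltW.
    have -> : eps = 2 / b * (eps * b / 4) * 1 + 2 / b * (eps * b / 4) * 1.
      by field; rewrite gt_eqF.
    move: hA hB RLc RLs; rewrite -/ck -/sk.
    set pA := prim (fun t => ck t * (Q t * f t)) b.
    set pB := prim (fun t => sk t * (Q t * f t)) b.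
    set rA := prim _ b; set rB := prim _ b => hA hB hA' hB'.
    have HA : `|pA + sg| <= eps * b / 4.
      move: hA hA'; rewrite /sg !ler_norml => /andP[? ?] /andP[? ?]; apply/andP; split; lra.
    have HB : `|pB| <= eps * b / 4.
      move: hB hB'; rewrite !ler_norml => /andP[? ?] /andP[? ?]; apply/andP; split; lra.
    apply: (le_trans (ler_normD _ _)).
    apply: lerD; rewrite normrM; apply: ler_pM => //.
    - by rewrite normrM (ger0_norm b2) ler_wpM2l.
    - exact: norm_cos_le1.
    - by rewrite normrM (ger0_norm b2) ler_wpM2l.
    - exact: norm_sin_le1.
- by move=> x; apply: (le_trans _ dele).
- by split; [exact: solution0 fE|exact: solution_end fb fE].
- by split; [exact: dsolution0|exact: dsolution_end fb].
Unshelve. all: by end_near.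
Qed.

End EdgeQuasimode.

(** * Quasimodes on the graph *)

Section Dirichlet.
Context {R : realType}.

(** Pigeonhole: the K + 1 fractional parts of 0, x, ..., K x fall into K cells of length 1 / K. *)
Lemma dirichlet_approximation (x : R) (K : nat) : 0 <= x -> (0 < K)%N ->
  exists n m : nat, (0 < n <= K)%N /\ `|n%:R * x - m%:R| < K%:R^-1.
Proof.
move=> x0 K0; have KR : 0 < K%:R :> R by rewrite ltr0n.
pose fl (i : nat) : nat := Num.truncn (i%:R * x).
have flP i : (fl i)%:R <= i%:R * x < (fl i)%:R + 1.
  by rewrite natr1; apply: truncn_itv; rewrite mulr_ge0.
pose cell i : nat := Num.truncn (K%:R * (i%:R * x - (fl i)%:R)).
have cellP i : (cell i)%:R <= K%:R * (i%:R * x - (fl i)%:R) < (cell i)%:R + 1.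
  rewrite natr1; apply: truncn_itv; rewrite mulr_ge0 ?subr_ge0//.
  by have /andP[] := flP i.
have cellK i : (cell i < K)%N.
  rewrite -(ltr_nat R); have /andP[h _] := cellP i; apply: (le_lt_trans h).
  rewrite -[ltRHS]mulr1 ltr_pM2l// ltrBlDl; by have /andP[] := flP i.
pose c (i : 'I_K.+1) : 'I_K := Ordinal (cellK i).
have /injectivePn [i [j ij cij]] : ~~ injectiveb c.
  by apply/negP => /injectiveP/leq_card; rewrite !card_ord ltnn.
wlog lt_ij : i j ij cij / (i < j)%N => [H|].
  have [lt|ge] := ltnP i j; first exact: (H i j).
  apply: (H j i); rewrite 1?eq_sym// ltn_neqAle ge andbT.
  by apply: contra_neq ij => /val_inj.
have flij : (fl i <= fl j)%N.
  rewrite truncn_ge_nat ?mulr_ge0//; have /andP[h _] := flP i; apply: (le_trans h).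
  by rewrite ler_wpM2r// ler_nat ltnW.
exists (j - i)%N, (fl j - fl i)%N; split.
  by rewrite subn_gt0 lt_ij/= (leq_trans (leq_subr _ _))// -ltnS.
rewrite !natrB ?(ltnW lt_ij)//.
have cc : cell i = cell j by have /(congr1 val) := cij.
have := cellP i; have := cellP j; rewrite cc => /andP[h1 h2] /andP[h3 h4].
rewrite -(ltr_pM2l KR) mulfV ?gt_eqF// -{1}(gtr0_norm KR) -normrM ltr_norml.
by apply/andP; split; lra.
Qed.

(** Dirichlet's denominator n may be small, for instance when [x] is rational. Asking for accuracy
    N^-2 leaves room to scale it by some t with N <= t n <= 2 N: the error becomes t / N^2, and t
    and t n are both at most 2 N. *)
Lemma dirichlet_approximation_large (x : R) (N : nat) : 0 <= x -> (0 < N)%N ->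
  exists n m : nat, (N <= n)%N /\ `|n%:R * x - m%:R| <= 4 / n%:R.
Proof.
move=> x0 N0; have NN : (0 < N * N)%N by rewrite muln_gt0 N0.
have [n [m [/andP[n0 nK] nm]]] := dirichlet_approximation x0 NN.
have nR : 0 < n%:R :> R by rewrite ltr0n.
have NR : 0 < N%:R :> R by rewrite ltr0n.
have [Nn|nN] := leqP N n.
  exists n, m; split=> //; apply: (le_trans (ltW nm)).
  apply: (@le_trans _ _ n%:R^-1); last by rewrite ler_peMl ?invr_ge0 ?ler1n.
  by rewrite lef_pV2 ?posrE ?ltr0n// ler_nat.
pose t := (N %/ n).+1; exists (t * n)%N, (t * m)%N.
have tn1 : (N <= t * n)%N by rewrite ltnW// ltn_ceil.
have tn2 : (t * n <= 2 * N)%N.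
  by rewrite mul2n -addnn /t mulSn leq_add ?leq_divM// ltnW.
have tN : (t <= 2 * N)%N by rewrite (leq_trans _ tn2)// leq_pmulr.
split=> //; rewrite !natrM -mulrA -mulrBr normrM ger0_norm//.
apply: (@le_trans _ _ (t%:R * (N * N)%:R^-1)); first by rewrite ler_wpM2l// ltW.
have tnR : 0 < t%:R * n%:R :> R by rewrite mulr_gt0// ltr0n.
rewrite ler_pdivlMr// natrM mulrAC ler_pdivrMr ?mulr_gt0//.
have h1 : t%:R * n%:R <= 2 * N%:R :> R by rewrite -!natrM ler_nat.
have h2 : t%:R <= 2 * N%:R :> R by rewrite -natrM ler_nat.
have -> : 4 * (N%:R * N%:R) = (2 * N%:R) * (2 * N%:R) :> R by ring.
by apply: ler_pM => //; exact: ltW.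
Qed.

End Dirichlet.

(** * Square integrable functions on an interval *)

Section SquareIntegrable.
Context {R : realType}.
Local Notation mfun := (@measurable_fun _ _ (measurableTypeR R) R).

Lemma L2_itvP (b : R) (f : R -> R) : L2_itv b f <->
  mfun `[0, b] f /\ intg `[0, b] (fun x => f x ^+ 2).
Proof.
have sqr_restrict : (fun x => (f \_ `[0, b]) x ^+ 2) = (fun x => f x ^+ 2) \_ `[0, b].
  by apply/funext => x; rewrite !patchE; case: ifP => // _; rewrite expr0n.
split.
  move=> fL; split.
    have := sub_Lfun_mfun fL; rewrite inE/= => mf.
    by apply/(measurable_restrictT _ _).2.
  have := Lfun2_integrable_sqr fL; rewrite sqr_restrict => fi.
  apply: (@eq_intg _ _ ((fun x => f x ^+ 2) \_ `[0, b])) => //.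
    by move=> x xb; rewrite patchE xb.
  exact: intgS fi.
move=> [mf fi]; have mf' : mfun setT (f \_ `[0, b]) by apply/(measurable_restrictT _ _).1.
rewrite /L2_itv inE; apply/andP; split; first by rewrite inE.
rewrite inE/= /finite_norm unlock; apply: poweR_lty.
have /integrableP[_] := intg_restrict (measurable_itv _) fi.
apply: le_lt_trans; rewrite le_eqVlt; apply/orP; left; apply/eqP.
apply: eq_integral => x _ /=; rewrite powR_mulrn// -sqr_restrict.
by rewrite normrX.
Qed.

Lemma bounded_L2 (b : R) (f : R -> R) : bounded_mfun f -> L2_itv b f.
Proof.
move=> [mf [M fM]]; apply/L2_itvP; split; first exact: measurable_funTS.
apply: (@intg_bounded _ _ _ _ (M * M)).
  by apply: measurable_funX; exact: measurable_funTS.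
by move=> x _; rewrite expr2 normrM ler_pM.
Qed.

Lemma L2_intg (b : R) (f : R -> R) : L2_itv b f -> intg `[0, b] f.
Proof.
move=> /L2_itvP[mf fi].
have ci : intg `[0, b] (fun=> 1 : R) by apply: continuous_intg => x; exact: cvg_cst.
have gi := intgD (measurable_itv _) ci fi.
apply: le_integrable gi => //; first exact/measurable_EFinP.
move=> x _; rewrite lee_fin [leRHS]ger0_norm; last by rewrite addr_ge0 ?sqr_ge0.
have := sqr_ge0 (`|f x| - 1); rewrite -[f x ^+ 2]real_normK ?num_real// sqrrB mulr1 expr1n.
have := sqr_ge0 `|f x|; have := normr_ge0 (f x); lra.
Qed.

Lemma L2_itvB (b : R) (f g : R -> R) : L2_itv b f -> L2_itv b g ->
  L2_itv b (fun x => f x - g x).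
Proof.
move=> /L2_itvP[mf fi] /L2_itvP[mg gi]; apply/L2_itvP.
have mfg : mfun `[0, b] (fun x => f x - g x) by exact: measurable_funB.
split=> //.
have si : intg `[0, b] (fun x => 2 * f x ^+ 2 + 2 * g x ^+ 2).
  by apply: intgD => //; exact: intgZ.
apply: le_integrable si => //.
  by apply/measurable_EFinP; exact: measurable_funX.
move=> x _; rewrite lee_fin ger0_norm ?sqr_ge0// ger0_norm.
  by have := sqr_ge0 (f x + g x); lra.
by rewrite addr_ge0// mulr_ge0// sqr_ge0.
Qed.

End SquareIntegrable.

(** * Gluing the three edges *)

Section GraphQuasimode.
Context {R : realType}.
Local Notation gfun := (edge -> R -> R).
Variables (a l : R) (q : gfun).
Hypotheses (a0 : 0 < a) (l0 : 0 < l).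
Hypothesis q_L1 : forall e, L1_itv (edge_len a l e) (q e).

Record graph_mode (lam eps : R) (phi dphi ddphi h : gfun) : Prop := GraphMode {
  gm_dom : in_dom a l q phi dphi ddphi;
  gm_bounded : forall e, bounded_mfun (phi e);
  gm_continuous : forall e, continuous (h e);
  gm_small : forall e x, `|h e x| <= eps;
  gm_Aop : forall e x, Aop q phi ddphi e x = lam * phi e x + h e x
}.

(* For [n l / a] close to [m], the frequencies [m pi / l] and [n pi / a] differ by
   O(1/n), hence their squares by O(1). *)
Lemma resonance (M0 : R) (N : nat) : exists n m : nat,
  [/\ (N <= n)%N, (N <= m)%N, M0 <= n%:R &
   `|(m%:R * pi / l) ^+ 2 - (n%:R * pi / a) ^+ 2| <=
     4 * pi / l * (2 * pi / a + 4 * pi / l)].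
Proof.
have la0 : 0 < l / a by rewrite divr_gt0.
(* Large enough for n l / a > N + 4; as m differs from n l / a by at most 4 / n <= 4, also m >=
   N. *)
pose N' := (Num.truncn (`|M0| + (N%:R + 4) / (l / a)) + N).+1.
have [n [m [Nn nm]]] := dirichlet_approximation_large (ltW la0) (ltn0Sn _ : 0 < N')%N.
have NR : `|M0| + (N%:R + 4) / (l / a) < n%:R.
  apply: (@lt_le_trans _ _ N'%:R); last by rewrite ler_nat.
  apply: (@lt_le_trans _ _ (Num.truncn (`|M0| + (N%:R + 4) / (l / a))).+1%:R).
    by have /andP[] := @truncn_itv R (`|M0| + (N%:R + 4) / (l / a)) (addr_ge0 (normr_ge0 _)
      (divr_ge0 (addr_ge0 (ler0n _ _) (ler0n _ _)) (ltW la0))).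
  by rewrite ler_nat /N' ltnS leq_addr.
have n0 : (0 < n)%N by exact: leq_trans Nn.
have nR : 0 < n%:R :> R by rewrite ltr0n.
have n1 : 1 <= n%:R :> R by rewrite ler1n.
have NR0 : 0 <= (N%:R + 4) / (l / a) by rewrite divr_ge0 ?(ltW la0)// addr_ge0.
exists n, m; split.
- by rewrite (leq_trans _ Nn)// /N' (leq_trans (leq_addl _ _) (leqnSn _)).
- rewrite -(ler_nat R).
  have h1 : N%:R + 4 <= n%:R * (l / a).
    by rewrite -ler_pdivrMr// (le_trans _ (ltW NR))// lerDr.
  have h2 : 4 / n%:R <= 4 :> R by rewrite ler_pdivrMr// ler_peMr.
  by move: nm; rewrite ler_norml => /andP[? ?]; lra.
- by apply: ltW; apply: le_lt_trans NR; rewrite (le_trans (ler_norm _))// lerDl.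
have pi0 : 0 < pi :> R := pi_gt0 R.
set d := m%:R * pi / l - n%:R * pi / a.
have dE : `|d| <= 4 * pi / l / n%:R.
  have -> : d = - (pi / l * (n%:R * (l / a) - m%:R)).
    by rewrite /d; field; rewrite !gt_eqF.
  rewrite normrN normrM gtr0_norm ?divr_gt0//.
  have -> : 4 * pi / l / n%:R = pi / l * (4 / n%:R) by ring.
  by rewrite ler_pM2l ?divr_gt0.
have -> : (m%:R * pi / l) ^+ 2 - (n%:R * pi / a) ^+ 2 = d * (2 * (n%:R * pi / a) + d).
  by rewrite /d; ring.
have c0 : 0 < 4 * pi / l by rewrite divr_gt0// mulr_gt0.
rewrite normrM; apply: (@le_trans _ _ (4 * pi / l / n%:R * (2 * (n%:R * pi / a) + 4 * pi /
  l / n%:R))).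
  apply: ler_pM => //; apply: (le_trans (ler_normD _ _)); apply: lerD => //.
  by rewrite ger0_norm// mulr_ge0// divr_ge0 ?(ltW a0)// mulr_ge0// ltW.
have -> : 4 * pi / l / n%:R * (2 * (n%:R * pi / a) + 4 * pi / l / n%:R) =
  4 * pi / l * (2 * pi / a + 4 * pi / l / n%:R / n%:R).
  by field; rewrite !gt_eqF.
rewrite ler_pM2l// lerD2l ler_pdivrMr// ler_pdivrMr//.
move: (4 * pi / l) c0 => c c0; have cn : c <= c * n%:R by rewrite ler_peMr// ltW.
by rewrite (le_trans cn)// ler_peMr// (le_trans _ cn)// ltW.
Qed.

Lemma graph_quasimode : exists Mb : R, forall (eps M0 : R) (N : nat), 0 < eps ->
  exists (n : nat) (lam : R) (phi dphi ddphi h : gfun),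
    [/\ (N <= n)%N, M0 <= lam, graph_mode lam eps phi dphi ddphi h,
        `|dphi e2 0| <= Mb &
        forall x, `|phi e2 x - cos (n%:R * pi / a * x)| <= eps].
Proof.
pose M1 := 4 * pi / l * (2 * pi / a + 4 * pi / l).
pose Q e := prim (q e) (edge_len a l e).
pose SQ := Q e1 + Q e2 + Q e3.
have al0 : 0 < 2 * a + l by rewrite addr_gt0// mulr_gt0.
(* [M1] is the bound of [resonance] on the difference of squared frequencies, [M2] bounds the shift
   on the ring, and [M] bounds both shifts. None depends on n, so the bound on the slope is fixed
   before [eps] and n. *)
pose M2 := (`|SQ| + l * M1) / (2 * a + l).
pose M := M1 + M2.
exists ((M * a + `|Q e2|) / 2) => eps M0 N eps0.
have edge_len_gt0 e : 0 < edge_len a l e by case: e.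
have [N1 _ E1] := edge_quasimode M (edge_len_gt0 e1) (q_L1 e1) eps0.
have [N2 _ E2] := edge_quasimode M (edge_len_gt0 e2) (q_L1 e2) eps0.
have [N3 _ E3] := edge_quasimode M (edge_len_gt0 e3) (q_L1 e3) eps0.
(* Gives k >= |M0| + M + 1, hence k^2 >= k, and lam = k^2 + s2 stays above M0. *)
pose B := (`|M0| + M + 1) * (a / pi).
have [n [m [Nn Nm Bn nm]]] := resonance B (maxn N (maxn N1 (maxn N2 N3))).
move: Nn Nm; rewrite !geq_max => /and4P[Nn _ N2n N3n] /and4P[_ N1m _ _].
set k := n%:R * pi / a in nm; set k1 := m%:R * pi / l in nm.
rewrite -/M1 in nm.
have M10 : 0 <= M1 by exact: le_trans nm.
have M20 : 0 <= M2 by rewrite divr_ge0 ?(ltW al0)// addr_ge0// mulr_ge0// ltW.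
(* The common eigenvalue is k^2 + s2 = k1^2 + s1; this s2 makes
   (s1 l - Q e1) + (s2 a - Q e2) + (s2 a - Q e3) = 0, the Kirchhoff condition. *)
pose s2 := (SQ + l * (k1 ^+ 2 - k ^+ 2)) / (2 * a + l).
pose s1 := s2 - (k1 ^+ 2 - k ^+ 2).
have s2M : `|s2| <= M2.
  rewrite /s2 /M2 normrM normfV (gtr0_norm al0) ler_pM2r ?invr_gt0//.
  by rewrite (le_trans (ler_normD _ _))// lerD2l normrM (gtr0_norm l0) ler_pM2l.
have s1M' : `|s1| <= M.
  by rewrite (le_trans (ler_normB _ _))// /M addrC lerD.
have s2M' : `|s2| <= M by rewrite (le_trans s2M)// /M lerDr.
have [f1 [g1 [h1 [m1 c1 [z1 b1] [d1 d1']]]]] := E1 m N1m s1 s1M'.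
(* The edges [e2] and [e3] share n and the shift, so both reach (-1)^n with slope 0 at the midpoint,
   as the vertex condition there demands. *)
have [f2 [g2 [h2 [m2 c2 [z2 b2] [d2 d2']]]]] := E2 n N2n s2 s2M'.
have [f3 [g3 [h3 [m3 c3 [z3 b3] [d3 d3']]]]] := E3 n N3n s2 s2M'.
pose pack (u1 u2 u3 : R -> R) : gfun := fun e => match e with e1 => u1 | e2 => u2 | e3 =>
  u3 end.
pose lam := k ^+ 2 + s2.
have lam1 : k1 ^+ 2 + s1 = lam by rewrite /lam /s1; ring.
pose phi := pack f1 f2 f3; pose dphi := pack g1 g2 g3; pose h := pack h1 h2 h3.
(* The second derivative is determined only almost everywhere. Reading it off the equation makes
   [Aop] equal to lam phi + h at every point, hence bounded, although [q e] times [phi e] need not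
   be square integrable. *)
pose ddphi e x := q e x * phi e x - lam * phi e x - h e x.
have em e : edge_mode (edge_len a l e) (q e) lam eps (phi e) (dphi e) (h e).
  by case: e => //=; rewrite -lam1.
have AE e x : Aop q phi ddphi e x = lam * phi e x + h e x by rewrite /Aop /ddphi; ring.
have bm e : bounded_mfun (phi e) by case: (em e).
have ch e : continuous (h e) by case: (em e).
have sh e x : `|h e x| <= eps by case: (em e).
exists n, lam, phi, dphi, ddphi, h; split => //.
- have pi0 := pi_gt0 R.
  have kB : `|M0| + M + 1 <= k.
    have -> : `|M0| + M + 1 = B * (pi / a).
      by rewrite /B -mulrA [a / pi * _]mulrA divfK ?gt_eqF// divff ?gt_eqF// mulr1.
    by rewrite /k -mulrA ler_pM2r// divr_gt0.
  have MM : 0 <= M by exact: addr_ge0.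
  have kk : k <= k ^+ 2.
    have := normr_ge0 M0; rewrite expr2 => M00; rewrite ler_peMl//; lra.
  have := ler_norm M0; move: s2M'; rewrite ler_norml /lam => /andP[? _] ?; lra.
- split => //; split => //.
  + by move=> e; exact: bounded_L2.
  + by move=> e; case: (em e).
  + by move=> e; case: (em e).
  + by move=> e; case: (em e).
  + by move=> e; case: (em e).
  + move=> e; apply: bounded_L2; split.
      rewrite (_ : Aop q phi ddphi e = fun x => lam * phi e x + h e x); last exact/funext.
      apply: measurable_funD; last exact: continuous_mfun.
      by apply: measurable_funM; [exact: measurable_cst|case: (bm e)].
    have [_ [C fC]] := bm e; exists (`|lam| * C + eps) => x; rewrite AE.
    by rewrite (le_trans (ler_normD _ _))// lerD// normrM ler_wpM2l.
  + by rewrite /= b2 b3.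
  + by rewrite /outL /= d2' d3' oppr0 addr0.
  + by rewrite /= z1 z2.
  + by rewrite /= z2 z3.
  + rewrite /out0 /= d1 d2 d3 /s1 /s2 /SQ /Q /=; field; rewrite gt_eqF//.
- rewrite /= d2 normrM [`|2^-1|]gtr0_norm// ler_pM2r// (le_trans (ler_normB _ _))//.
  by rewrite lerD// normrM (gtr0_norm a0) ler_wpM2r// ltW.
Qed.

End GraphQuasimode.

(** * The moment equation *)

Section Duhamel.
Context {R : realType}.
Local Notation mu := (@lebesgue_measure R).
Implicit Types (T om : R).

Lemma is_derive_cos_rev om T x :
  is_derive x (1 : R) (fun t => cos (om * (T - t))) (om * sin (om * (T - x))).
Proof.
have D1 : is_derive x (1 : R) (fun=> T) 0 by exact: is_derive_cst.
have D := is_derive_scale om (is_derive_sub D1 (is_derive_id x 1)).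
have E : is_derive x (1 : R) (fun t => cos (om * (T - t)))
  (- sin (om * (T - x)) * (om * (0 - 1))).
  exact: (@is_derive1_comp R cos (fun t => om * (T - t)) x _ _ (is_derive_cos _) D).
apply: (is_derive_eq E).
by rewrite sub0r mulrN1 mulrNN mulrC.
Qed.

Lemma is_derive_sin_rev om T x :
  is_derive x (1 : R) (fun t => sin (om * (T - t))) (- (om * cos (om * (T - x)))).
Proof.
have D1 : is_derive x (1 : R) (fun=> T) 0 by exact: is_derive_cst.
have D := is_derive_scale om (is_derive_sub D1 (is_derive_id x 1)).
have E : is_derive x (1 : R) (fun t => sin (om * (T - t)))
  (cos (om * (T - x)) * (om * (0 - 1))).
  exact: (@is_derive1_comp R sin (fun t => om * (T - t)) x _ _ (is_derive_sin _) D).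
apply: (is_derive_eq E).
by rewrite sub0r mulrN1 mulrN mulrC.
Qed.

Lemma continuous_cos_rev om T : continuous (fun t => cos (om * (T - t))).
Proof. by apply: is_derive_continuous => x; exact: is_derive_cos_rev. Qed.

Lemma continuous_sin_rev om T : continuous (fun t => sin (om * (T - t))).
Proof. by apply: is_derive_continuous => x; exact: is_derive_sin_rev. Qed.

Lemma prim_parts_itv (T : R) (c dc f : R -> R) : 0 <= T -> intg `[0, T] f ->
  (forall y, is_derive y (1 : R) c (dc y)) -> continuous dc ->
  prim (fun t => dc t * prim f t) T = c T * prim f T - prim (fun t => c t * f t) T.
Proof.
move=> T0 fi cd cdc.
have := prim_parts T0 (intg_restrict (measurable_itv _) fi) cd cdc.
rewrite prim_restrict// (@eq_prim _ _ (fun t => dc t * prim f t)).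
  move=> ->; congr (_ - _); apply: eq_prim => t tT.
  by rewrite patchE mem_set// /= in_itv.
by move=> t /andP[_ tT]; rewrite prim_restrict.
Qed.

Lemma H1_itvE T f df : H1_itv T f df ->
  intg `[0, T] df /\ (forall x, 0 <= x <= T -> f x = f 0 + prim df x).
Proof. by move=> [dfL fE]; split => //; exact: L2_intg. Qed.

Lemma H1_itv_intg T f df : H1_itv T f df -> 0 <= T -> intg `[0, T] f.
Proof.
move=> /H1_itvE[dfi fE] T0.
apply: (@eq_intg _ _ (fun x => f 0 + prim (df \_ `[0, T]) x)) => //.
  move=> x; rewrite inE/= in_itv/= => /[dup] xT /andP[_ xT'].
  by rewrite prim_restrict// -fE.
apply: continuous_intg => x; apply: cvgD; first exact: cvg_cst.
by apply: prim_continuous; exact: intg_restrict.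
Qed.

(** The function cos(om (T - t)) solves the adjoint equation with value 1 and slope 0 at T. Two
    integrations by parts against it leave only m'(T), as m and m' vanish at 0. *)
Lemma duhamel T m dm ddm om : 0 <= T -> H2_itv T m dm ddm -> m 0 = 0 -> dm 0 = 0 ->
  dm T = prim (fun t => cos (om * (T - t)) * (ddm t + om ^+ 2 * m t)) T.
Proof.
move=> T0 [Hm Hdm] m0 dm0.
have [dmi mE] := H1_itvE Hm; have [ddmi dmE] := H1_itvE Hdm.
have mi := H1_itv_intg Hm T0.
have TT : 0 <= T <= T by rewrite T0 lexx.
have cc := @continuous_cos_rev om T; have cs := @continuous_sin_rev om T.
pose oc t := - om * (om * cos (om * (T - t))).
pose os t := om * sin (om * (T - t)).
have cos_ : continuous os by move=> t; apply: cvgM; [exact: cvg_cst|exact: cs].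
have coc : continuous oc.
  by move=> t; apply: cvgM; [exact: cvg_cst|apply: cvgM; [exact: cvg_cst|exact: cc]].
have ds y : is_derive y (1 : R) os (oc y).
  by apply: (is_derive_eq (is_derive_scale om (is_derive_sin_rev om T y)));
    rewrite /oc mulrN mulNr.
have P1 := prim_parts_itv T0 ddmi (is_derive_cos_rev om T) cos_.
have P2 := prim_parts_itv T0 dmi ds coc.
rewrite subrr mulr0 cos0 mul1r in P1.
rewrite {1}/os subrr mulr0 sin0 mulr0 mul0r sub0r in P2.
rewrite (@eq_prim _ _ (fun t => cos (om * (T - t)) * ddm t - oc t * m t)) => [|t _];
  last first.
  by rewrite /oc; ring.
rewrite prim_sub.
- rewrite (@eq_prim _ (fun t => oc t * m t) (fun t => oc t * prim dm t)) => [|t tT];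
    last first.
    by rewrite mE// m0 add0r.
  rewrite P2 opprK (@eq_prim _ (fun t => os t * dm t) (fun t => os t * prim ddm t)) => [|t
    tT]; last first.
    by rewrite dmE// dm0 add0r.
  by rewrite P1 addrC subrK dmE// dm0 add0r.
- by apply: (@intgM _ _ _ _ 1) => //; [exact: continuous_mfun|move=> *; exact: norm_cos_le1].
- have [M M0 ocM] := continuous_itv_bounded 0 T coc.
  apply: (@intgM _ _ _ _ M) => //; first exact: continuous_mfun.
Qed.

Lemma prim_cos_control T f df om : 0 <= T -> 0 < om -> H10_itv T f df ->
  `|prim (fun t => cos (om * (T - t)) * f t) T| <=
    (\int[mu]_(t in `[0, T]) `|df t|) / om.
Proof.
move=> T0 om0 [/H1_itvE[dfi fE] f0 fT].
have ds y : is_derive y (1 : R) (fun t => - om^-1 * sin (om * (T - t))) (cos (om * (T - y))).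
  apply: (is_derive_eq (is_derive_scale (- om^-1) (is_derive_sin_rev om T y))).
  by rewrite mulrNN mulrA mulVf ?mul1r// gt_eqF.
have P := prim_parts_itv T0 dfi ds (@continuous_cos_rev om T).
rewrite (@eq_prim _ _ (fun t => cos (om * (T - t)) * prim df t)) => [|t tT]; last first.
  by rewrite fE// f0 add0r.
rewrite P subrr mulr0 sin0 mulr0 mul0r sub0r normrN [leRHS]mulrC.
have cs := @continuous_sin_rev om T.
have si : intg `[0, T] (fun t => sin (om * (T - t)) * df t).
  by apply: (@intgM _ _ _ _ 1) => //; [exact: continuous_mfun|move=> *; exact: norm_sin_le1].
rewrite (@eq_prim _ _ (fun t => - om^-1 * (sin (om * (T - t)) * df t))) => [|t _]; last first.
  by rewrite mulrA.
have om1 : 0 < om^-1 by rewrite invr_gt0.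
rewrite primZ// normrM normrN (gtr0_norm om1) ler_pM2l//.
apply: le_norm_Rintegral => //; first exact: intg_norm.
by move=> t _; rewrite normrM ler_piMl// norm_sin_le1.
Qed.

Lemma ae_bounded_Rintegral T g rho : 0 <= T -> intg `[0, T] g ->
  {ae mu, forall t, 0 < t < T -> `|g t| <= rho} -> 0 <= rho ->
  \int[mu]_(t in `[0, T]) `|g t| <= rho * T.
Proof.
move=> T0 gi grho rho0.
(* The almost everywhere bound is given inside the interval; the endpoints are null. *)
have go : intg `]0, T[ g by apply: intgS gi => //; exact: subset_itv_oo_cc.
have -> : \int[mu]_(t in `[0, T]) `|g t| = \int[mu]_(t in `]0, T[) `|g t|.
  rewrite -Rintegral_itv_obnd_cbnd; last first.
    by apply: intgS (intg_norm gi) => //; exact: subset_itv_oc_cc.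
  by rewrite -Rintegral_itv_bndo_bndc//; exact: intg_norm.
rewrite -lee_fin /Rintegral fineK; last by apply: integrable_fin_num => //; exact: intg_norm.
have muT : (mu `]0%R, T[ <= T%:E)%E.
  by rewrite lebesgue_measure_itv/= lte_fin; case: ifP => // _; rewrite sube0.
rewrite EFinM; apply: (@le_trans _ _ (rho%:E * mu `]0%R, T[)%E); last first.
  by apply: lee_wpmul2l.
have mg : measurable_fun `]0, T[ (fun t => (g t)%:E).
  by apply/measurable_EFinP; exact: intg_measurable go.
have := @integral_le_bound _ _ _ mu `]0, T[ (EFin \o g) rho%:E _ mg _ _.
apply => //.
Qed.

Lemma velocity_bound T f df m dm ddm (om beta rho : R) :
  0 <= T -> 0 < om -> 0 <= rho -> H10_itv T f df -> H2_itv T m dm ddm ->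
  m 0 = 0 -> dm 0 = 0 ->
  {ae mu, forall t, 0 < t < T -> `|ddm t + om ^+ 2 * m t - f t * beta| <= rho} ->
  `|dm T| <= `|beta| * ((\int[mu]_(t in `[0, T]) `|df t|) / om) + rho * T.
Proof.
move=> T0 om0 rho0 Hf Hm m0 dm0 ae_rho.
have [Hm1 Hdm] := Hm; have mi := H1_itv_intg Hm1 T0.
have [ddmi _] := H1_itvE Hdm.
have fi : intg `[0, T] f by case: Hf => Hf _ _; exact: H1_itv_intg Hf T0.
pose g t := ddm t + om ^+ 2 * m t - f t * beta.
have bfi : intg `[0, T] (fun t => beta * f t) by exact: intgZ.
have gi : intg `[0, T] g.
  apply: intgB => //; first by apply: intgD => //; exact: intgZ.
  by apply: eq_intg bfi => // t _; rewrite mulrC.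
have cc := @continuous_cos_rev om T.
have ci (u : R -> R) : intg `[0, T] u -> intg `[0, T] (fun t => cos (om * (T - t)) * u t).
  by move=> ui; apply: (@intgM _ _ _ _ 1) => //; [exact: continuous_mfun|move=> *;
    exact: norm_cos_le1].
rewrite (duhamel om T0 Hm m0 dm0).
rewrite (@eq_prim _ _ (fun t => beta * (cos (om * (T - t)) * f t) + cos (om * (T - t)) * g
  t)) => [|t _]; last first.
  by rewrite /g; ring.
rewrite primD; [|by apply: intgZ => //; exact: ci|exact: ci].
rewrite primZ; last exact: ci.
apply: (le_trans (ler_normD _ _)); apply: lerD.
  by rewrite normrM ler_wpM2l//; exact: prim_cos_control.
apply: le_trans (ae_bounded_Rintegral T0 gi ae_rho rho0).
apply: le_norm_Rintegral => //; [exact: ci|exact: intg_norm|].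
by move=> t _; rewrite normrM ler_piMl// norm_cos_le1.
Qed.

(* The two weak derivatives of m come from the definitions of solution and of final
   velocity. *)
Lemma H2_velocity_unique T m dm dm' ddm ddm' : 0 < T ->
  H2_itv T m dm ddm -> H2_itv T m dm' ddm' -> dm T = dm' T.
Proof.
move=> T0 [Hm Hdm] [Hm' Hdm'].
have [dmi mE] := H1_itvE Hm; have [ddmi dmE] := H1_itvE Hdm.
have [dmi' mE'] := H1_itvE Hm'; have [ddmi' dmE'] := H1_itvE Hdm'.
(* A continuous extension of [dm - dm'] to the whole line. Its primitive vanishes on [[0, T]], so
   [D] vanishes inside, and continuity carries this to T. *)
pose D x := dm 0 - dm' 0 + prim ((fun t => ddm t - ddm' t) \_ `[0, T]) x.
have cD : continuous D.
  move=> x; apply: cvgD; first exact: cvg_cst.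
  by apply: prim_continuous; apply: intg_restrict => //; exact: intgB.
have DE x : 0 <= x <= T -> D x = dm x - dm' x.
  move=> /[dup] xT /andP[x0 xT']; rewrite /D prim_restrict// prim_sub.
  - by rewrite (dmE x xT) (dmE' x xT); ring.
  - by apply: intgS ddmi => //; exact: subset_itvl.
  - by apply: intgS ddmi' => //; exact: subset_itvl.
have PD x : 0 <= x <= T -> prim D x = 0.
  move=> /[dup] xT /andP[x0 xT'].
  rewrite (@eq_prim _ _ (fun t => dm t - dm' t)); last first.
    by move=> t /andP[t0 tx]; rewrite DE// t0 (le_trans tx).
  rewrite prim_sub.
  - have := mE x xT; rewrite mE'// => /addrI ->; exact: subrr.
  - by apply: intgS dmi => //; exact: subset_itvl.
  - by apply: intgS dmi' => //; exact: subset_itvl.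
have D0 x : 0 < x < T -> D x = 0.
  move=> /andP[x0 xT]; have [_ <-] := prim_is_derive cD x0.
  have -> : 'D_1 (prim D) x = 'D_1 (cst 0) x; last by rewrite derive_cst.
  apply: near_eq_derive; near=> y; rewrite PD//; apply/andP; split; apply: ltW.
    by near: y; exact: lt_nbhsr.
  by near: y; exact: lt_nbhsl.
apply/eqP; rewrite -subr_eq0 -DE ?lexx ?ltW//; apply/eqP.
have DT : D x @[x --> T^'-] --> D T by apply/cvg_at_left_filter/cD.
have D0' : D x @[x --> T^'-] --> 0.
  apply: cvg_near_cst; near=> x; apply: D0; apply/andP; split.
    by near: x; exact: nbhs_left_gt.
  by near: x; exact: nbhs_left_lt.
exact: (cvg_unique _ DT D0').
Unshelve. all: by end_near. Qed.

End Duhamel.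

(** * The gliding hump *)

Section Hump.
Context {R : realType}.

(** In the pairing with the i-th cosine the earlier terms vanish by orthogonality, the i-th gives
    8^-i a / 2, and the later ones together are at most 8^-i a / 7 in the supremum estimate. The
    difference exceeds 8^-i a / 4. *)
Lemma lacunary_function (a : R) (n : nat -> nat) : 0 < a ->
  (forall j, (0 < n j)%N) -> injective n ->
  exists psi, bounded_mfun psi /\ forall i,
    a / 4 * 8^-1 ^+ i <= prim (fun t => psi t * cos ((n i)%:R * pi / a * t)) a.
Proof.
move=> a0 n0 n_inj.
pose c j t : R := cos ((n j)%:R * pi / a * t).
have cc j : continuous (c j) by exact: continuous_cosM.
pose u J t := \sum_(j < J) 8^-1 ^+ j * c j t.
have cu J : continuous (u J).
  elim: J => [|J IH] x.
    rewrite /u; under eq_fun do rewrite big_ord0; exact: cvg_cst.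
  rewrite /u; under eq_fun do rewrite big_ord_recr/=.
  by apply: cvgD; [exact: IH|apply: cvgM; [exact: cvg_cst|exact: cc]].
have du J x : `|u J.+1 x - u J x| <= 1 * 8^-1 ^+ J.
  rewrite /u big_ord_recr/= addrAC subrr add0r mul1r normrM normrX gtr0_norm//.
  by rewrite ler_piMr// norm_cos_le1.
have r01 : 0 < (8^-1 : R) < 1 by apply/andP; split; lra.
have [psi mpsi psiu] := geometric_uniform_limit r01 ler01
  (fun J => continuous_mfun (@cu J) measurableT) du.
have E8 : 1 / (1 - 8^-1) = 8 / 7 :> R by field.
rewrite E8 in psiu.
have psib : bounded_mfun psi.
  split=> //; exists (8 / 7) => x; have := psiu 0%N x.
  by rewrite /u big_ord0 subr0 expr0 mulr1.
exists psi; split => // i.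
have ucont j i' : continuous (fun t => c j t * c i' t).
  by move=> x; apply: cvgM; exact: cc.
have orth J : prim (fun t => u J t * c i t) a =
    \sum_(j < J) 8^-1 ^+ j * prim (fun t => c j t * c i t) a.
  elim: J => [|J IH].
    rewrite big_ord0 (@eq_prim _ _ (fun=> 0)); last by move=> t _; rewrite /u big_ord0 mul0r.
    by rewrite /prim Rintegral_cst//= mul0r.
  rewrite big_ord_recr/= -IH -primZ; last exact: continuous_intg.
  rewrite -primD.
  - by apply: eq_prim => t _; rewrite /u big_ord_recr/=; ring.
  - by apply: continuous_intg => x; apply: cvgM; [exact: cu|exact: cc].
  - by apply: intgZ => //; exact: continuous_intg.
have main : prim (fun t => u i.+1 t * c i t) a = 8^-1 ^+ i * (a / 2).
  rewrite orth big_ord_recr/= big1 ?add0r; last first.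
    move=> j _; rewrite prim_mode_orthogonal ?mulr0//.
    by apply/eqP => /n_inj ji; have := ltn_ord j; rewrite ji ltnn.
  by rewrite /c prim_mode_cos2.
have ci : intg `[0, a] (c i) by exact: continuous_intg.
have [mp [M pM]] := psib.
have pci : intg `[0, a] (fun t => psi t * c i t).
  by apply: (@intgM _ _ _ _ M) => //; exact: measurable_funTS.
have uci : intg `[0, a] (fun t => u i.+1 t * c i t).
  by apply: continuous_intg => x; apply: cvgM; [exact: cu|exact: cc].
have rem : `|prim (fun t => psi t * c i t) a - prim (fun t => u i.+1 t * c i t) a|
    <= 8 / 7 * 8^-1 ^+ i.+1 * (a - 0).
  rewrite -prim_sub//; apply: Rintegral_itv_le; [exact: ltW|exact: intgB|] => t _.
  by rewrite -mulrBl normrM -[leRHS]mulr1 ler_pM// norm_cos_le1.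
move: rem; rewrite main exprS subr0 ler_norml => /andP[h _].
have p0 : 0 <= (8^-1 : R) ^+ i by rewrite exprn_ge0.
rewrite -/(c i); move: h p0; move: (8^-1 ^+ i) (prim _ a) => p P h p0.
have := mulr_ge0 p0 (ltW a0); lra.
Qed.

End Hump.

(** * A uniform bound on the solution *)

Section Bounded.
Context {R : realType}.
Local Notation mu := (@lebesgue_measure R).
Variables (a l : R) (q : edge -> R -> R).
Hypotheses (a0 : 0 < a) (l0 : 0 < l).

(** The L^1 norm suits pairings with the residual, which is small in the supremum norm. *)
Definition L1norm (e : edge) (v : R -> R) := \int[mu]_(t in `[0, edge_len a l e]) `|v t|.

Let len0 e : 0 < edge_len a l e. Proof. by case: e. Qed.

Lemma L1norm_le e (v : R -> R) : L2_itv (edge_len a l e) v ->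
  L1norm e v <= edge_len a l e + L2_inner (edge_len a l e) v v.
Proof.
move=> vL; have vi := L2_intg vL; have /L2_itvP[mv v2] := vL.
have c1 : intg `[0, edge_len a l e] (fun=> 1 : R).
  by apply: continuous_intg => x; exact: cvg_cst.
have -> : edge_len a l e + L2_inner (edge_len a l e) v v =
    \int[mu]_(t in `[0, edge_len a l e]) (1 + v t ^+ 2).
  rewrite RintegralD// Rintegral_cst//= lebesgue_measure_itv/= lte_fin len0 sube0 mul1r.
  by congr (_ + _); apply: eq_Rintegral => t _; rewrite expr2.
apply: le_Rintegral => //; [exact: intg_norm|exact: intgD|].
move=> t _; have := sqr_ge0 (`|v t| - 1); rewrite -[v t ^+ 2]real_normK ?num_real//.
rewrite sqrrB mulr1 expr1n; have := normr_ge0 (v t); lra.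
Qed.

Lemma solution_bounded T f1 f2 u : is_solution a l q T f1 f2 u ->
  exists U, forall t e, 0 <= t <= T -> L1norm e (u t e) <= U.
Proof.
move=> [uL uc _].
(* Compactness: a bound [M], sent to infinity, that works near each [t0] works on all of
   [[0, T]]. *)
have /compact_near_coveringP := @segment_compact R 0 T.
move=> /(_ R +oo (fun M t => 0 <= t <= T -> forall e, L1norm e (u t e) <= M) _).
case.
  move=> t0 t0T.
  have t0T' : 0 <= t0 <= T by move: t0T; rewrite /= in_itv.
  have /cvgrPdist_lt/(_ 1 ltr01) /= := uc t0 t0T'.
  rewrite near_withinE => near_t0.
  (* By [L1norm_le] the difference from [u t0] has L^1 norm at most the edge length plus 1. Summing
     over the edges makes [B] independent of [e]. *)
  pose B := L1norm e1 (u t0 e1) + L1norm e2 (u t0 e2) + L1norm e3 (u t0 e3) + l + a + 1.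
  have L1_ge0 e v : 0 <= L1norm e v by exact: Rintegral_ge0.
  exists ([set t | 0 <= t <= T -> Hdist a l (u t) (u t0) < 1], [set M | B <= M]) => /=;
    first split.
  - apply: filterS near_t0 => t h tT; have := h; rewrite /= in_itv/= => /(_ tT).
    by rewrite sub0r normrN ger0_norm// sqrtr_ge0.
  - by apply: nbhs_pinfty_ge; exact: num_real.
  move=> [t M] [/= ht BM] tT e.
  have wL e' : L2_itv (edge_len a l e') (fun x => u t e' x - u t0 e' x).
    by apply: L2_itvB; exact: uL.
  have w1 : L2_inner (edge_len a l e) (fun x => u t e x - u t0 e x)
      (fun x => u t e x - u t0 e x) <= 1.
    have i0 e' : 0 <= L2_inner (edge_len a l e') (fun x => u t e' x - u t0 e' x)
        (fun x => u t e' x - u t0 e' x).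
      by apply: Rintegral_ge0 => x _; rewrite -expr2 sqr_ge0.
    have := ht tT; rewrite /Hdist /Hnorm -[ltRHS]sqrtr1 ltr_sqrt// /H_inner /= => H.
    by move: (i0 e1) (i0 e2) (i0 e3) => /=; case: e => /=; lra.
  apply: (@le_trans _ _ (L1norm e (fun x => u t e x - u t0 e x) + L1norm e (u t0 e))).
    rewrite /L1norm -RintegralD//; last 2 first.
      by apply: intg_norm; apply: L2_intg; exact: wL.
      by apply: intg_norm; apply: L2_intg; exact: uL.
    apply: le_Rintegral => //.
    - by apply: intg_norm; apply: L2_intg; exact: uL.
    - apply: intgD => //; first by apply: intg_norm; apply: L2_intg; exact: wL.
      by apply: intg_norm; apply: L2_intg; exact: uL.
    - by move=> x _; rewrite -[in leLHS](subrK (u t0 e x) (u t e x)) ler_normD.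
  have := L1norm_le (wL e); have := L1_ge0 e1 (u t0 e1); have := L1_ge0 e2 (u t0 e2).
  have := L1_ge0 e3 (u t0 e3); move: BM w1; rewrite /B; case: e;
    rewrite /= => BM w1 p3 p2 p1 h; have := a0; have := l0; lra.
move=> M [_ MP]; exists (M + 1) => t e tT; apply: (MP (M + 1) _ t) => //.
by rewrite ltrDl.
Qed.

End Bounded.

(** * Pairing the final velocity with a quasimode *)

Section Observation.
Context {R : realType}.
Local Notation mu := (@lebesgue_measure R).
Local Notation gfun := (edge -> R -> R).
Variables (a l : R) (q : gfun).
Hypotheses (a0 : 0 < a) (l0 : 0 < l).

Lemma H_inner_Aop lam eps phi dphi ddphi h (u : gfun) :
  graph_mode a l q lam eps phi dphi ddphi h -> L2_graph a l u ->
  H_inner a l u (Aop q phi ddphi) = lam * H_inner a l u phi + H_inner a l u h.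
Proof.
move=> [_ bm ch sh AE] uL.
have E e : L2_inner (edge_len a l e) (u e) (Aop q phi ddphi e) =
    lam * L2_inner (edge_len a l e) (u e) (phi e) + L2_inner (edge_len a l e) (u e) (h e).
  have ui := L2_intg (uL e); have [mp [M pM]] := bm e.
  have upi : intg `[0, edge_len a l e] (fun x => u e x * phi e x).
    by apply: (@intgMl _ _ _ _ M) => //; exact: measurable_funTS.
  have uhi : intg `[0, edge_len a l e] (fun x => u e x * h e x).
    by apply: (@intgMl _ _ _ _ eps) => //; exact: continuous_mfun.
  rewrite /L2_inner -RintegralZl// -RintegralD//; last exact: intgZ.
  by apply: eq_Rintegral => x _; rewrite AE; ring.
by rewrite /H_inner !E; ring.
Qed.

Lemma norm_H_inner_le eps U (u h : gfun) : 0 <= eps -> L2_graph a l u ->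
  (forall e, continuous (h e)) -> (forall e x, `|h e x| <= eps) ->
  (forall e, L1norm a l e (u e) <= U) -> `|H_inner a l u h| <= 3 * U * eps.
Proof.
move=> eps0 uL ch sh uU.
have E e : `|L2_inner (edge_len a l e) (u e) (h e)| <= U * eps.
  have ui := L2_intg (uL e).
  apply: (@le_trans _ _ (L1norm a l e (u e) * eps)); last by rewrite ler_wpM2r.
  rewrite /L1norm -RintegralZr//; last exact: intg_norm.
  apply: le_norm_Rintegral => //.
  - by apply: (@intgMl _ _ _ _ eps) => //; exact: continuous_mfun.
  - apply: (@intgMl _ _ _ _ eps) => //; last exact: intg_norm.
    by move=> x _; rewrite ger0_norm.
  - by move=> x _; rewrite normrM ler_wpM2l.
rewrite /H_inner; apply: (le_trans (ler_normD _ _)).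
have -> : 3 * U * eps = U * eps + U * eps + U * eps by ring.
by apply: lerD => //; apply: (le_trans (ler_normD _ _)); apply: lerD.
Qed.

(** This is [velocity_bound] with [om] the square root of [lam], [beta] the slope at the node and
    [rho = 3 * U * eps]: each of the three edges contributes at most [U * eps] to the pairing with
    the residual. *)
Lemma observation_bound T lam eps U phi dphi ddphi h f df u psi :
  0 < T -> 0 < lam -> 0 <= eps -> graph_mode a l q lam eps phi dphi ddphi h ->
  H10_itv T f df -> is_solution a l q T (fun=> 0) f u ->
  (forall t e, 0 <= t <= T -> L1norm a l e (u t e) <= U) ->
  velocity_at a l q T u psi ->
  `|H_inner a l psi phi| <= `|dphi e2 0| *
    ((\int[mu]_(t in `[0, T]) `|df t|) / Num.sqrt lam) + 3 * U * eps * T.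
Proof.
move=> T0 lam0 eps0 gm Hf sol uU vel.
have dom := gm_dom gm; have [uL _ smom] := sol.
have [dm [ddm [Hm m0 dm0 eqm]]] := smom _ _ _ dom.
have [dm' [ddm' [Hm' <-]]] := vel _ _ _ dom.
rewrite -(H2_velocity_unique T0 Hm Hm').
have U0 : 0 <= U.
  apply: le_trans (uU 0 e1 _); last by rewrite lexx ltW.
  exact: Rintegral_ge0.
apply: (velocity_bound (ltW T0) _ _ Hf Hm m0 dm0).
- by rewrite sqrtr_gt0.
- by rewrite !mulr_ge0.
apply: filterS eqm; first exact: (ae_filter_ringOfSetsType mu).
move=> t ht tT; have tT' : 0 <= t <= T by case/andP: tT => ? ?; rewrite !ltW.
have uLt : L2_graph a l (u t) by exact: uL.
have := ht tT; rewrite (H_inner_Aop gm uLt) oppr0 mul0r add0r /out0 => E.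
rewrite (sqr_sqrtr (ltW lam0)) /moment.
have -> : ddm t + lam * H_inner a l (u t) phi - f t * dphi e2 0 =
  - H_inner a l (u t) h by rewrite -E; ring.
rewrite normrN; apply: norm_H_inner_le => //; first exact: gm_continuous gm.
- exact: gm_small gm.
- by move=> e; exact: uU.
Qed.

End Observation.

(** * Failure of exact controllability: an unreachable final velocity *)

Theorem corollary1 (R : realType) (a l : R) (q : edge -> R -> R)
  (a_gt0 : 0 < a) (l_gt0 : 0 < l)
  (q_L1 : forall e, L1_itv (edge_len a l e) (q e)) (T : R) (T_gt0 : 0 < T) :
  ~ (exists C : R,
      forall (phi1 : edge -> R -> R) (d1 dr : R -> R) (phi2 : edge -> R -> R),
        H10_graph a l phi1 d1 dr -> L2_graph a l phi2 ->
        exists (f2 df2 : R -> R) (u : R -> edge -> R -> R),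
          [/\ H10_itv T f2 df2,
              is_solution a l q T (fun=> 0) f2 u,
              ae_eq_graph a l (u T) phi1,
              velocity_at a l q T u phi2 &
              H1_itv_norm T f2 df2
                <= C * (H1_graph_norm a l phi1 d1 dr + Hnorm a l phi2)]).
Proof.
move=> [C controllable].
have [Mb modes] := graph_quasimode a_gt0 l_gt0 q_L1.
have eps_gt0 j : 0 < (16^-1 : R) ^+ j by rewrite exprn_gt0.
(* [p] holds the accuracy index j and a lower bound for the mode number. *)
pose good (p : nat * nat) (n : nat) := (p.2 <= n)%N /\
  exists lam phi dphi ddphi h,
    [/\ (16 ^+ p.1) ^+ 2 <= lam, graph_mode a l q lam (16^-1 ^+ p.1) phi dphi ddphi h,
        `|dphi e2 0| <= Mb &
        forall x, `|phi e2 x - cos (n%:R * pi / a * x)| <= 16^-1 ^+ p.1].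
have [F FP] : {F & forall p, good p (F p)}.
  apply: choice => -[j N].
  have [n [lam [phi [dphi [ddphi [h [Nn Ml gm dM near]]]]]]] :=
    modes _ ((16 ^+ j) ^+ 2) N (eps_gt0 j).
  by exists n; split => //; exists lam, phi, dphi, ddphi, h.
(* Each step asks for a mode number above the previous one, so the numbers are distinct, as
   orthogonality requires. Starting from 1 keeps them positive. *)
pose n := fix n j := if j is i.+1 then F (i.+1, (n i).+1) else F (0%N, 1%N).
have nS i : (n i < n i.+1)%N by have [] := FP (i.+1, (n i).+1).
have n_good j : exists N, good (j, N) (n j) by case: j => [|j]; eexists; exact: FP.
have n_mono : {homo n : i j / (i < j)%N} by apply: homo_ltn => //; exact: ltn_trans.
have n_inj : injective n.
  move=> i j nij; case: (ltngtP i j) => // /n_mono; by rewrite nij ltnn.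
have n_gt0 j : (0 < n j)%N.
  case: j => [|j]; first by have [] := FP (0%N, 1%N).
  by apply: leq_ltn_trans (nS j).
have [psi [psib psiP]] := lacunary_function a_gt0 n_gt0 n_inj.
(* The target velocity lives on [e2] alone, where closeness of the quasimodes to cosines is
   recorded; the target position is 0. *)
pose phi2 e : R -> R := if e is e2 then psi else cst 0.
have bm0 : bounded_mfun (cst (0 : R)).
  by split; [exact: measurable_cst|exists 0 => x; rewrite normr0].
have H1_0 b f : (forall x, f x = 0) -> H1_itv b f (cst (0 : R)).
  move=> f0; split; first exact: bounded_L2.
  by move=> x _; rewrite !f0 add0r Rintegral_cst//= mul0r.
have phi1P : H10_graph a l (fun _ _ => 0) (cst (0 : R)) (cst 0).
  have z x : on_ring a (fun _ _ => 0 : R) x = 0 by rewrite /on_ring; case: ifP.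
  split; [split|by rewrite z|by rewrite !z].
  - by move=> e; exact: bounded_L2.
  - exact: H1_0.
  - exact: H1_0.
have phi2P : L2_graph a l phi2 by case; exact: bounded_L2.
have [f [df [u [Hf sol _ vel _]]]] := controllable _ _ _ _ phi1P phi2P.
have [U uU] := solution_bounded a_gt0 l_gt0 sol.
set J := \int[lebesgue_measure]_(t in `[0, T]) `|df t|.
have [mpsi [Mp psiM]] := psib.
(* The three sources of error, each to be multiplied by 16^-j: the mode replaced by its cosine in
   the pairing with [psi], the control term, and the residual. *)
pose K := a * Mp + Mb * J + 3 * U * T.
(* The hump contributes at least 8^-j a / 4; dividing by 16^-j leaves 2^j against a constant
   independent of j. *)
have bound j : a / 4 * 2 ^+ j <= K.
  have [N [_ [lam [phi [dphi [ddphi [h [Ml gm dM near_cos]]]]]]]] := n_good j.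
  rewrite /= in Ml gm near_cos.
  have lam0 : 0 < lam by apply: (lt_le_trans _ Ml); rewrite exprn_gt0// exprn_gt0.
  have := observation_bound T_gt0 lam0 (ltW (eps_gt0 j)) gm Hf sol uU vel.
  set eps := 16^-1 ^+ j in gm near_cos *; have eps0 : 0 < eps by exact: eps_gt0.
  have eps16 : (16 ^+ j)^-1 = eps by rewrite /eps exprVn.
  have J0 : 0 <= J by apply: Rintegral_ge0.
  have om : (Num.sqrt lam)^-1 <= eps.
    rewrite -eps16 lef_pV2 ?posrE ?sqrtr_gt0 ?exprn_gt0//.
    have -> : 16 ^+ j = Num.sqrt ((16 ^+ j) ^+ 2) :> R.
      by rewrite sqrtr_sqr ger0_norm// exprn_ge0.
    by rewrite ler_sqrt// ltW.
  have -> : H_inner a l phi2 phi = prim (fun t => psi t * phi e2 t) a.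
    have z (b : R) v : L2_inner b (cst 0) v = 0.
      rewrite /L2_inner (@eq_Rintegral _ _ _ _ _ (fun=> 0)) => [|x _]; last by rewrite mul0r.
      by rewrite Rintegral_cst//= mul0r.
    by rewrite /H_inner /= !z addr0 add0r.
  have -> : `|dphi e2 0| * (J / Num.sqrt lam) = `|dphi e2 0| * J * (Num.sqrt lam)^-1 by ring.
  have [mp [Ml' pM]] := gm_bounded gm e2.
  have psi_int (v : R -> R) : bounded_mfun v -> intg `[0, a] (fun t => psi t * v t).
    move=> [mv [Mv vM]]; apply: intg_bounded => [|x _].
      by apply: measurable_funM; exact: measurable_funTS.
    by rewrite normrM; apply: ler_pM; [| |exact: psiM|exact: vM].
  have cosb : bounded_mfun (fun t => cos ((n j)%:R * pi / a * t)).
    split; last by exists 1 => x; exact: norm_cos_le1.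
    by apply: continuous_mfun => //; exact: continuous_cosM.
  have near_psi : `|prim (fun t => psi t * phi e2 t) a -
      prim (fun t => psi t * cos ((n j)%:R * pi / a * t)) a| <= Mp * eps * (a - 0).
    have i1 := psi_int _ (gm_bounded gm e2); have i2 := psi_int _ cosb.
    rewrite -prim_sub//; apply: Rintegral_itv_le; [exact: ltW|exact: intgB|] => t _.
    by rewrite -mulrBr normrM; apply: ler_pM.
  have hump := psiP j.
  have -> : a / 4 * 2 ^+ j = a / 4 * 8^-1 ^+ j * 16 ^+ j.
    rewrite -[RHS]mulrA -exprMn; congr (_ * _ ^+ _); by field.
  rewrite -ler_pdivlMr ?exprn_gt0// eps16.
  move: near_psi hump; move: (prim _ a) (prim _ a) => P1 P2 h1 h2 h3.
  have h4 : `|dphi e2 0| * J * (Num.sqrt lam)^-1 <= Mb * J * eps.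
    by apply: ler_pM; [exact: mulr_ge0|rewrite invr_ge0 sqrtr_ge0|rewrite ler_wpM2r|exact: om].
  have := ler_norm P2; have := ler_norm P1.
  move: h1; rewrite ler_norml subr0 /K => /andP[? ?] ? ?; lra.
have a4 : 0 < a / 4 by rewrite divr_gt0.
pose j := (Num.truncn (`|K| / (a / 4))).+1.
have Kj : `|K| < a / 4 * j%:R.
  rewrite mulrC -ltr_pdivrMr//.
  by have /andP[] := @truncn_itv R (`|K| / (a / 4)) (divr_ge0 (normr_ge0 _) (ltW a4)).
have := bound j; apply/negP; rewrite -ltNge.
apply: (le_lt_trans (ler_norm K)); apply: (lt_le_trans Kj).
by rewrite ler_pM2l// -natrX ler_nat ltnW// ltn_expl.
Qed.
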